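(* Let $n\ge1$, $\delta>0$, and $\mu,\lambda^*\in\mathbb{R}$. The tensor multipliers $M_b$ and $M_s$ can be represented in terms of derivatives of the scalar multipliers as follows. (1) If $\beta<n$, then for all $\nu\in\mathbb{R}^n$, $$M_b(\nu)=-\frac{(n+2)\,\mu\,c^{\delta,\beta}}{c^{\delta,\beta+2}}\left(\nabla\nabla m^{\delta,\beta+2}(\nu)+2I\right)=-\frac{(n+2)\,\mu\,c^{\delta,\beta}}{c^{\delta,\beta+2}}\left(\delta^2 f_b''\left(-\tfrac14\|\nu\|^2\delta^2\right)\nu\otimes\nu+\left(2-2f_b'\left(-\tfrac14\|\nu\|^2\delta^2\right)\right)I\right),$$ where $f_b(z)=z\;{}_2F_3\left(1,\frac{n-\beta}{2};2,\frac{n+2}{2},\frac{n+2-\beta}{2};z\right)$. (2) If $\beta<n+2$, then for all $\nu\in\mathbb{R}^n$, $$M_s(\nu)=-\frac{\lambda^*-\mu}{4}\,\nabla m^{\delta,\beta}(\nu)\otimes\nabla m^{\delta,\beta}(\nu)=-(\lambda^*-\mu)\left(f_s'\left(-\tfrac14\|\nu\|^2\delta^2\right)\right)^2\nu\otimes\nu,$$ where $f_s(z)=z\;{}_2F_3\left(1,\frac{n+2-\beta}{2};2,\frac{n+2}{2},\frac{n+4-\beta}{2};z\right)$.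
   Context: $B_\delta(0)$ is the ball of radius $\delta$ centered at $0$ in $\mathbb{R}^n$; $v\otimes w$ is the matrix with entries $v_iw_j$; $I$ is the $n\times n$ identity matrix; $\nabla\nabla m$ denotes the Hessian matrix of $m$. For an exponent $\beta<n+2$, set $$c^{\delta,\beta}=\left(\frac{1}{2n}\int_{B_\delta(0)}\frac{\|w\|^2}{\|w\|^\beta}\,dw\right)^{-1}=\frac{2(n+2-\beta)\Gamma\left(\frac n2+1\right)}{\pi^{n/2}\delta^{n+2-\beta}}.$$ The scalar multiplier (Fourier multiplier of the nonlocal Laplacian $u\mapsto c^{\delta,\beta}\int_{B_\delta(x)}\frac{u(y)-u(x)}{\|y-x\|^\beta}\,dy$) is $$m^{\delta,\beta}(\nu)=c^{\delta,\beta}\int_{B_\delta(0)}\frac{\cos(\nu\cdot w)-1}{\|w\|^\beta}\,dw .$$ The tensor multipliers are $$M_b(\nu)=(n+2)\,\mu\,c^{\delta,\beta}\int_{B_\delta(0)}\frac{w\otimes w}{\|w\|^{\beta+2}}\big(\cos(\nu\cdot w)-1\big)\,dw,$$ $$M_s(\nu)=-(\lambda^*-\mu)\frac{(c^{\delta,\beta})^2}{4}\left(\int_{B_\delta(0)}\frac{w}{\|w\|^\beta}\sin(\nu\cdot w)\,dw\right)\otimes\left(\int_{B_\delta(0)}\frac{w}{\|w\|^\beta}\sin(\nu\cdot w)\,dw\right).$$ Generalized hypergeometric function: ${}_pF_q(a_1,\dots,a_p;b_1,\dots,b_q;z)=\sum_{k\ge0}\frac{(a_1)_k\cdots(a_p)_k}{(b_1)_k\cdots(b_q)_k}\frac{z^k}{k!}$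 with $(a)_k=a(a+1)\cdots(a+k-1)$. *)

(* Defs.v *)
From HB Require Import structures.
From mathcomp Require Import all_boot all_order all_algebra.
From mathcomp Require Import all_classical all_reals all_analysis.

Set Implicit Arguments.
Unset Strict Implicit.
Unset Printing Implicit Defensive.

Import Order.TTheory GRing.Theory Num.Theory.
Import numFieldNormedType.Exports.

Local Open Scope classical_set_scope.
Local Open Scope ring_scope.

(* The library has Lebesgue measure on R and binary product measures only.
   Lebesgue measure on R^n is built here on n-tuples, whose sigma-algebra is
   the Borel product one, by pushing lebesgue_measure \x lebesgue_tuple n
   forward along (x, w) |-> x :: w. *)
Section lebesgue_tuple.
Context {R : realType}.
Local Notation RT := (measurableTypeR R).

Section step.
Variables (n : nat) (mu : {sigma_finite_measure set (n.-tuple RT) -> \bar R}).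

Definition tcons (p : RT * n.-tuple RT) : n.+1.-tuple RT :=
  [tuple of p.1 :: p.2].

Lemma measurable_tcons : measurable_fun [set: RT * n.-tuple RT] tcons.
Proof. exact: measurable_cons. Qed.

Definition lebesgue_cons : set (n.+1.-tuple RT) -> \bar R :=
  pushforward (lebesgue_measure \x mu)%E tcons.

Let lebesgue_cons0 : lebesgue_cons set0 = 0%E.
Proof. by rewrite /lebesgue_cons /pushforward preimage_set0 measure0. Qed.

Let lebesgue_cons_ge0 A : (0 <= lebesgue_cons A)%E.
Proof. by rewrite /lebesgue_cons /pushforward; exact: measure_ge0. Qed.

Let lebesgue_cons_sigma_additive : semi_sigma_additive lebesgue_cons.
Proof.
move=> F mF tF mUF; rewrite /lebesgue_cons /pushforward preimage_bigcup.
apply: measure_semi_sigma_additive.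
- by move=> k; rewrite -[X in measurable X]setTI; exact: measurable_tcons.
- apply/trivIsetP => /= i j _ _ ij; rewrite -preimage_setI.
  by move/trivIsetP : tF => /(_ _ _ _ _ ij) ->//; rewrite preimage_set0.
- by rewrite -preimage_bigcup -[X in measurable X]setTI; exact: measurable_tcons.
Qed.

HB.instance Definition _ := isMeasure.Build _ _ _ lebesgue_cons
  lebesgue_cons0 lebesgue_cons_ge0 lebesgue_cons_sigma_additive.

Let lebesgue_cons_sigma_finite : sigma_finite setT lebesgue_cons.
Proof.
have /sigma_finiteP[F [TF ndF Foo]] :=
  sigma_finiteT (@lebesgue_measure R : {sigma_finite_measure set RT -> \bar R}).
have /sigma_finiteP[G [TG ndG Goo]] := sigma_finiteT mu.
pose tl (w : n.+1.-tuple RT) : n.-tuple RT := [tuple of behead w].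
pose H k := [set w : n.+1.-tuple RT | F k (thead w) /\ G k (tl w)].
have tlE x w : tl (tcons (x, w)) = w by exact: val_inj.
have tconsH k : tcons @^-1` H k = F k `*` G k.
  by apply/seteqP; split=> -[x w] /=; rewrite /H /= theadE tlE.
exists H.
  apply/esym/seteqP; split=> // w _.
  have [i _ Fi] : (\bigcup_k F k) (thead w) by rewrite -TF.
  have [j _ Gj] : (\bigcup_k G k) (tl w) by rewrite -TG.
  exists (maxn i j) => //; split.
    by move: Fi; exact/subsetPset/ndF/leq_maxl.
  by move: Gj; exact/subsetPset/ndG/leq_maxr.
move=> k; have [mF Fk] := Foo k; have [mG Gk] := Goo k; split.
  apply: measurableI; rewrite -[X in measurable X]setTI.
    exact: measurable_tnth.
  exact: (@measurable_behead _ _ n).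
rewrite /lebesgue_cons /pushforward tconsH product_measure1E//.
by rewrite lte_mul_pinfty// ge0_fin_numE.
Qed.

HB.instance Definition _ := Measure_isSigmaFinite.Build _ _ _ lebesgue_cons
  lebesgue_cons_sigma_finite.

End step.

Fixpoint lebesgue_tuple (n : nat) :
    {sigma_finite_measure set (n.-tuple RT) -> \bar R} :=
  match n with
  | 0 => \d_([tuple] : 0.-tuple RT)
  | m.+1 => lebesgue_cons (lebesgue_tuple m)
  end.

Lemma lebesgue_tuple_box (n : nat) (A : 'I_n -> set RT) :
  (forall i, measurable (A i)) ->
  lebesgue_tuple n [set w | forall i, A i (tnth w i)] =
  (\prod_(i < n) lebesgue_measure (A i))%E.
Proof.
elim: n A => [|n IH] A mA.
  rewrite big_ord0 /= diracE mem_set//; by case.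
rewrite big_ord_recl /= /lebesgue_cons /pushforward -IH// -product_measure1E//.
  congr product_measure1; apply/seteqP; split=> [[x w] /= Aw|[x w] /= [Ax Aw] i].
    split=> [|i]; first exact: (Aw ord0).
    by have := Aw (lift ord0 i); rewrite tnthS.
  by case: (unliftP ord0 i) => [j ->|->//]; rewrite tnthS.
rewrite (_ : mkset _ = \bigcap_(i in setT) ((fun w : n.-tuple RT => tnth w i) @^-1` A (lift ord0 i))).
  apply: fin_bigcap_measurable => // i _.
  by rewrite -[X in measurable X]setTI; exact: measurable_tnth.
by apply/seteqP; split=> w /= Aw i; [move=> _|]; exact: Aw.
Qed.

End lebesgue_tuple.

Section euclidean.
Context {R : realType} {n : nat}.
Implicit Types (u v w nu : 'rV[R]_n) (f : 'rV[R]_n -> R).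

Definition dot u v : R := \sum_i u 0 i * v 0 i.

(* The library norm `|v| on row vectors is the sup norm. *)
Definition enorm v : R := Num.sqrt (\sum_i v 0 i ^+ 2).

Definition tens v w : 'M[R]_n := \matrix_(i, j) (v 0 i * w 0 j).

Definition row_of_tuple (w : n.-tuple (measurableTypeR R)) : 'rV[R]_n :=
  \row_i (tnth w i : R).

Definition ball_integral (delta : R) (F : 'rV[R]_n -> R) : R :=
  \int[lebesgue_tuple n]_(w in [set w | enorm (row_of_tuple w) < delta])
     F (row_of_tuple w).

Definition grad f v : 'rV[R]_n := \row_i 'D_(delta_mx 0 i) f v.

Definition hessian f v : 'M[R]_n :=
  \matrix_(i, j) 'D_(delta_mx 0 i) ('D_(delta_mx 0 j) f) v.

End euclidean.

(* The singular kernels below evaluate at w = 0 to a junk value, as 0 `^ a is 0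
   for a <> 0 and 1 for a = 0 and x / 0 = 0; {0} is Lebesgue-null for n >= 1. *)
Section multipliers.
Context {R : realType}.
Variable n : nat.
Variables (delta beta : R).

Definition cnorm : R :=
  ((2 * n%:R)^-1 *
   ball_integral delta (fun w : 'rV[R]_n => enorm w ^+ 2 / enorm w `^ beta))^-1.

Definition multiplier (nu : 'rV[R]_n) : R :=
  cnorm *
  ball_integral delta (fun w => (cos (dot nu w) - 1) / enorm w `^ beta).

Definition Mb (mu : R) (nu : 'rV[R]_n) : 'M[R]_n :=
  ((n%:R + 2) * mu * cnorm) *:
  \matrix_(i, j) ball_integral delta (fun w =>
    tens w w i j / enorm w `^ (beta + 2) * (cos (dot nu w) - 1)).

Definition sine_moment (nu : 'rV[R]_n) : 'rV[R]_n :=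
  \row_i ball_integral delta (fun w =>
    w 0 i / enorm w `^ beta * sin (dot nu w)).

Definition Ms (mu lambda : R) (nu : 'rV[R]_n) : 'M[R]_n :=
  (- (lambda - mu) * (cnorm ^+ 2 / 4)) *:
  tens (sine_moment nu) (sine_moment nu).

End multipliers.
Arguments cnorm {R} n delta beta.
Arguments multiplier {R} n delta beta nu.
Arguments Mb {R} n delta beta mu nu.
Arguments sine_moment {R} n delta beta nu.
Arguments Ms {R} n delta beta mu lambda nu.

Section hypergeometric.
Context {R : realType}.

Definition pochhammer (a : R) (k : nat) : R := \prod_(i < k) (a + i%:R).

Definition hypergeometric (la lb : seq R) (z : R) : R :=
  limn (series (fun k =>
    (\prod_(a <- la) pochhammer a k) / (\prod_(b <- lb) pochhammer b k) *
    (z ^+ k / k`!%:R))).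

Definition fb (n : nat) (beta z : R) : R :=
  z * hypergeometric [:: 1; (n%:R - beta) / 2]
        [:: 2; (n%:R + 2) / 2; (n%:R + 2 - beta) / 2] z.

Definition fs (n : nat) (beta z : R) : R :=
  z * hypergeometric [:: 1; (n%:R + 2 - beta) / 2]
        [:: 2; (n%:R + 2) / 2; (n%:R + 4 - beta) / 2] z.

End hypergeometric.

(* Main.v *)
(* Let c and m be the normalising constant and the scalar multiplier for an
   exponent b < n + 2 (part (1) is the case b = beta + 2).  Write
   S_i(nu) = int v_i sin(nu.v) / |v|^b and C_ij(nu) = int v_i v_j cos(nu.v) / |v|^b.
   Since |v|^2 / |v|^b is integrable on the ball, second order Taylor bounds for
   sin and cos give d_i m = - c S_i and d_i d_j m = - c C_ij, and C_ij(0) is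
   2 delta_ij / c by rotation invariance: these are the identities with
   derivatives of m.
   For the hypergeometric ones, m = (4 / delta^2) f(- |nu|^2 delta^2 / 4) is
   checked coefficient by coefficient.  Rotation invariance gives
   int (nu.v)^(2k) |v|^(2l) / |v|^b = |nu|^(2k) M(k, l); reading this identity at
   nu = e_0 + t e_j and comparing the coefficients of t^2 yields
   (n + 2k) M(k + 1, l) = (2k + 1) M(k, l + 1), which leaves the radial moments
   M(0, l).  By homogeneity the l-th moment over the ball |v|^2 < t is a power of
   t, and integrating the indicator of |v|^2 < t over t gives a recursion in l. *)
Require Import Defs.
From HB Require Import structures.
From mathcomp Require Import all_boot all_order all_algebra.
From mathcomp Require Import all_classical all_reals all_analysis.
From mathcomp Require Import measurable_realfun.
From mathcomp Require Import ring lra.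

Set Implicit Arguments.
Unset Strict Implicit.
Unset Printing Implicit Defensive.

Import Order.TTheory GRing.Theory Num.Theory.
Import numFieldNormedType.Exports.

Local Open Scope classical_set_scope.
Local Open Scope ring_scope.

(** * Invariance of Lebesgue measure under affine maps and plane rotations *)

(** The measure on tuples is built one coordinate at a time, so the changes of variables within
    direct reach are those moving a single coordinate: hence rotations as shears, and rotation
    invariance by induction, one plane at a time. It is stated for nonnegative extended-real
    integrands, so that Tonelli applies before anything is known to be finite; this is why only even
    powers of nu.v enter. The obstacle is the weight |v|^-b: for n <= b < n + 2 its own integral
    over the ball diverges. A numerator of order |v|^2 at the origin is needed, so the moment
    recursions start at order one, the cosine series is used without its constant term, and
    finiteness comes from a geometric bound over dyadic shells. The Taylor bounds give directional
    derivatives only. Differentiability of m and of its gradient, which the statement also asserts,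
    comes from the closed form in f, a power series converging everywhere; equating the two
    expressions of the derivatives links the sine and cosine moments to f' and f''. *)

Section lebesgue_invariance.
Context {R : realType}.
Local Notation RT := (measurableTypeR R).
Local Notation leb := (@lebesgue_measure R).
Local Open Scope ereal_scope.

(** Uniqueness of Lebesgue measure: r times its pushforward along x |-> r x + a still gives []u, v]]
    the measure v - u. *)
Lemma ge0_integral_affine (r a : R) (f : RT -> \bar R) : (0 < r)%R ->
  measurable_fun setT f -> (forall x, 0 <= f x) ->
  \int[leb]_x f x = r%:E * \int[leb]_x f (r * x + a)%R.
Proof.
move=> r0 mf f0.
pose phi (x : RT) : RT := (r * x + a)%R.
have mphi : measurable_fun setT phi.
  by apply: measurable_funD => //; exact: measurable_funM.
pose m : {measure set RT -> \bar R} := pushforward leb phi.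
have r0' : (0 <= r)%R by exact: ltW.
pose m' : {measure set RT -> \bar R} := mscale (NngNum r0') (m mphi).
have E A : measurable A -> leb A = m' A.
  apply: lebesgue_measure_unique => _ [[u v] _ <-].
  have E : phi @^-1` `]u, v]%classic = `]((u - a) / r)%R, ((v - a) / r)%R]%classic.
    apply/seteqP; split => x /=; rewrite /phi !in_itv/= => /andP[ux xv].
      by rewrite ltr_pdivrMr// ler_pdivlMr//; apply/andP; split; lra.
    move: ux xv; rewrite ltr_pdivrMr// ler_pdivlMr// => ux xv.
    by apply/andP; split; lra.
  rewrite /m' /= /mscale /m /= /pushforward E.
  rewrite !lebesgue_measure_itv/= !lte_fin ltr_pM2r ?invr_gt0// ltrD2r.
  case: ifPn => _; last by rewrite mule0.
  rewrite -!EFinB -EFinM; congr EFin; field; exact: lt0r_neq0.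
transitivity (\int[m']_x f x).
  by apply: eq_measure_integral => A mA _; exact: E.
rewrite ge0_integral_mscale//=; congr *%E.
by rewrite ge0_integral_pushforward.
Qed.

Lemma ge0_integral_oppr (f : RT -> \bar R) :
  measurable_fun setT f -> (forall x, 0 <= f x) ->
  \int[leb]_x f x = \int[leb]_x f (- x)%R.
Proof.
move=> mf f0.
have mN : measurable_fun setT (-%R : RT -> RT) by [].
pose m : {measure set RT -> \bar R} := pushforward leb (-%R : RT -> RT).
transitivity (\int[m mN]_x f x).
  by apply: eq_measure_integral => A mA _; exact/esym/lebesgue_measureN.
by rewrite ge0_integral_pushforward.
Qed.

End lebesgue_invariance.

Section plane_rotation.
Context {R : realType}.
Local Notation RT := (measurableTypeR R).
Local Notation leb := (@lebesgue_measure R).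
Local Open Scope ereal_scope.

(** For fixed y the shear is a translation in x; Tonelli makes x the inner variable. *)
Lemma ge0_integral_shear1 (t : R) (f : RT * RT -> \bar R) :
  measurable_fun setT f -> (forall p, 0 <= f p) ->
  \int[leb]_x \int[leb]_y f (x, y) = \int[leb]_x \int[leb]_y f (x + t * y, y)%R.
Proof.
move=> mf f0.
pose h (p : RT * RT) := f (p.1 + t * p.2, p.2)%R.
have mh : measurable_fun setT h.
  apply: measurableT_comp => //; apply: measurable_fun_pair => //.
  by apply: measurable_funD => //; exact: measurable_funM.
apply: (etrans (fubini_tonelli f mf f0)).
apply: (etrans _ (esym (fubini_tonelli h mh (fun=> f0 _)))).
apply: eq_integral => y _.
have := @ge0_integral_affine R 1 (t * y) (fun x => f (x, y)) ltr01.
rewrite mul1e => ->//.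
  by apply: eq_integral => x _; rewrite mul1r.
apply: measurableT_comp => //; exact: measurable_pair2.
Qed.

Lemma ge0_integral_shear2 (t : R) (f : RT * RT -> \bar R) :
  measurable_fun setT f -> (forall p, 0 <= f p) ->
  \int[leb]_x \int[leb]_y f (x, y) = \int[leb]_x \int[leb]_y f (x, y + t * x)%R.
Proof.
move=> mf f0; apply: eq_integral => x _.
have := @ge0_integral_affine R 1 (t * x) (fun y => f (x, y)) ltr01.
rewrite mul1e => ->//.
  by apply: eq_integral => y _; rewrite mul1r.
apply: measurableT_comp => //; exact: measurable_pair1.
Qed.

(* A rotation of angle not in pi Z is a product of three shears. *)
Lemma ge0_integral_rotation (c s : R) (f : RT * RT -> \bar R) :
  (c ^+ 2 + s ^+ 2 = 1)%R -> s != 0%R ->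
  measurable_fun setT f -> (forall p, 0 <= f p) ->
  \int[leb]_x \int[leb]_y f (x, y) =
  \int[leb]_x \int[leb]_y f (c * x + s * y, - s * x + c * y)%R.
Proof.
(* For c = cos a and s = sin a this is t = tan (a / 2); the three shears have parameters t, -s,
   t. *)
move=> cs s0 mf f0; pose t := ((1 - c) / s)%R.
pose f1 (p : RT * RT) := f (p.1 + t * p.2, p.2)%R.
pose f2 (p : RT * RT) := f1 (p.1, p.2 + - s * p.1)%R.
have mf1 : measurable_fun setT f1.
  apply: measurableT_comp => //; apply: measurable_fun_pair => //.
  by apply: measurable_funD => //; exact: measurable_funM.
have mf2 : measurable_fun setT f2.
  apply: measurableT_comp => //; apply: measurable_fun_pair => //.
  by apply: measurable_funD => //; exact: measurable_funM.
apply: (etrans (ge0_integral_shear1 t mf f0)).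
apply: (etrans (ge0_integral_shear2 (- s) mf1 (fun=> f0 _))).
apply: (etrans (ge0_integral_shear1 t mf2 (fun=> f0 _))).
have ts : (t * s = 1 - c)%R by rewrite /t divfK.
have tc : (t * (1 + c) = s)%R.
  by rewrite /t mulrAC -subr_sqr expr1n -cs addrAC subrr add0r expr2 mulfK.
apply: eq_integral => x _; apply: eq_integral => y _; congr (f (_, _)).
  transitivity ((1 - t * s) * x + t * (2 - t * s) * y)%R; first by rewrite /=; ring.
  by rewrite ts -[in RHS]tc; ring.
by transitivity (- s * x + (1 - t * s) * y)%R; [rewrite /=; ring|rewrite ts; ring].
Qed.

(** The one-dimensional case of rotation invariance, where only the reflection x |-> -x is at hand.
    It also covers the plane case b = 0, in which the rotation would have sine 0 and the shear
    decomposition fails. *)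
Lemma ge0_integral_abs_scale (a : R) (g : RT * RT -> \bar R) :
  measurable_fun setT g -> (forall p, 0 <= g p) ->
  \int[leb]_x g (a * x, x ^+ 2)%R = \int[leb]_x g (`|a| * x, x ^+ 2)%R.
Proof.
move=> mg g0; have [a0|a0] := leP 0%R a; first by rewrite (ger0_norm a0).
pose h (x : RT) := g (`|a| * x, x ^+ 2)%R.
have mh : measurable_fun setT h.
  apply: measurableT_comp => //; apply: measurable_fun_pair => //.
apply/esym/(etrans (ge0_integral_oppr mh (fun=> g0 _))).
by apply: eq_integral => x _; rewrite /h/= (ltr0_norm a0) mulrNN sqrrN.
Qed.

(** The rotation with cosine a / r and sine b / r, where r is the norm of (a, b), carries r x to a x
    + b y and fixes x^2 + y^2. *)
Lemma ge0_integral_plane_radial (a b : R) (g : RT * RT -> \bar R) :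
  measurable_fun setT g -> (forall p, 0 <= g p) ->
  \int[leb]_x \int[leb]_y g (a * x + b * y, x ^+ 2 + y ^+ 2)%R =
  \int[leb]_x \int[leb]_y
     g (Num.sqrt (a ^+ 2 + b ^+ 2) * x, x ^+ 2 + y ^+ 2)%R.
Proof.
move=> mg g0; set r := Num.sqrt _.
have msq : measurable_fun setT (fun p : RT * RT => (p.1 ^+ 2 + p.2 ^+ 2)%R : RT).
  by apply: measurable_funD; apply: measurable_funX.
have [b0|b0] := eqVneq b 0%R.
  rewrite /r b0 expr0n addr0 sqrtr_sqr.
  have mG : measurable_fun setT (fun p : RT * RT =>
      \int[leb]_y g (p.1, p.2 + y ^+ 2)%R).
    apply: (measurable_fun_fubini_tonelli_F
      (fun q : (RT * RT) * RT => g (q.1.1, q.1.2 + q.2 ^+ 2)%R)) => //.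
    apply: measurableT_comp => //; apply: measurable_fun_pair => //=.
      by apply: measurableT_comp.
    apply: measurable_funD; first exact: measurableT_comp.
    exact: measurable_funX.
  have G0 (p : RT * RT) : 0 <= \int[leb]_y g (p.1, p.2 + y ^+ 2)%R.
    by apply: integral_ge0 => y _; exact: g0.
  apply: (etrans _ (ge0_integral_abs_scale a mG G0)).
  by apply: eq_integral => x _; apply: eq_integral => y _; rewrite mul0r addr0.
have r2 : (r ^+ 2 = a ^+ 2 + b ^+ 2)%R by rewrite sqr_sqrtr// addr_ge0// sqr_ge0.
have r0 : r != 0%R.
  rewrite -sqrf_eq0 r2 gt_eqF// ltr_wpDl ?sqr_ge0//.
  by rewrite lt_def sqr_ge0 sqrf_eq0 b0.
pose h (p : RT * RT) := g (r * p.1, p.1 ^+ 2 + p.2 ^+ 2)%R.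
have mh : measurable_fun setT h.
  apply: measurableT_comp => //; apply: measurable_fun_pair => //.
  exact: measurable_funM.
have cs1 : ((a / r) ^+ 2 + (b / r) ^+ 2 = 1)%R.
  by rewrite !expr_div_n -mulrDl -r2 divff// sqrf_eq0.
have s0 : (b / r != 0)%R by rewrite mulf_neq0// invr_eq0.
apply/esym/(etrans (ge0_integral_rotation cs1 s0 mh (fun=> g0 _))).
apply: eq_integral => x _; apply: eq_integral => y _; rewrite /h/=; congr (g (_, _)).
  by field.
transitivity (((a / r) ^+ 2 + (b / r) ^+ 2) * (x ^+ 2 + y ^+ 2))%R; first by ring.
by rewrite cs1 mul1r.
Qed.

End plane_rotation.

(** * Rotation invariance in n dimensions *)

Section radial.
Context {R : realType}.
Local Notation RT := (measurableTypeR R).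
Local Notation leb := (@lebesgue_measure R).

Definition sqn n (v : 'rV[R]_n) : R := (\sum_i v 0 i ^+ 2)%R.

Lemma sqn_ge0 n (v : 'rV[R]_n) : (0 <= sqn v)%R.
Proof. by apply: sumr_ge0 => i _; exact: sqr_ge0. Qed.

Definition tail_row n (v : 'rV[R]_n.+1) : 'rV[R]_n := \row_i v 0 (lift ord0 i).

Lemma row_of_tuple_tcons0 n x (w : n.-tuple RT) :
  row_of_tuple (tcons (x, w)) 0 ord0 = x.
Proof. by rewrite mxE. Qed.

Lemma sqn_tcons n x (w : n.-tuple RT) :
  sqn (row_of_tuple (tcons (x, w))) = (x ^+ 2 + sqn (row_of_tuple w))%R.
Proof.
rewrite /sqn big_ord_recl mxE; congr (_ + _)%R.
by apply: eq_bigr => i _; rewrite !mxE tnthS.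
Qed.

Lemma sqn_tail n (v : 'rV[R]_n.+1) : sqn v = (v 0 ord0 ^+ 2 + sqn (tail_row v))%R.
Proof.
rewrite /sqn big_ord_recl; congr (_ + _)%R.
by apply: eq_bigr => i _; rewrite !mxE.
Qed.

Lemma dot_tcons n (v : 'rV[R]_n.+1) x (w : n.-tuple RT) :
  dot v (row_of_tuple (tcons (x, w))) =
  (v 0 ord0 * x + dot (tail_row v) (row_of_tuple w))%R.
Proof.
rewrite /dot big_ord_recl mxE; congr (_ + _)%R.
by apply: eq_bigr => i _; rewrite !mxE tnthS.
Qed.

Lemma measurable_row_coord n (i : 'I_n) :
  measurable_fun setT (fun w : n.-tuple RT => row_of_tuple w 0 i : RT).
Proof.
rewrite (_ : (fun _ => _) = (@tnth n RT ^~ i)); first exact: measurable_tnth.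
by apply/funext => w; rewrite mxE.
Qed.

Lemma measurable_dot n (v : 'rV[R]_n) :
  measurable_fun setT (fun w : n.-tuple RT => dot v (row_of_tuple w) : RT).
Proof.
apply: measurable_sum => i; apply: measurable_funM => //.
exact: measurable_row_coord.
Qed.

Lemma measurable_sqn n :
  measurable_fun setT (fun w : n.-tuple RT => sqn (row_of_tuple w) : RT).
Proof.
apply: measurable_sum => i; apply: measurable_funX.
exact: measurable_row_coord.
Qed.

Lemma ge0_integral_lebesgue_tupleS n (f : n.+1.-tuple RT -> \bar R) :
  measurable_fun setT f -> (forall w, 0 <= f w)%E ->
  (\int[lebesgue_tuple n.+1]_w f w =
  \int[leb]_x \int[lebesgue_tuple n]_w f (tcons (x, w)))%E.
Proof.
move=> mf f0; rewrite /= /lebesgue_cons.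
apply: (etrans (ge0_integral_pushforward (@measurable_tcons R n) _ _ mf _)) => //.
apply: (fubini_tonelli1 (f \o @tcons R n)) => //.
apply: measurableT_comp => //; exact: measurable_tcons.
by move=> p; exact: f0.
Qed.

(** For a fixed first coordinate x, the induction hypothesis replaces the tail of v by its norm on
    the second axis; a plane rotation then merges the coefficients of the first two axes into |v|.
    Letting [g] depend on |w|^2 as well is what allows x^2 to be absorbed into [g] in the
    induction. *)
Lemma ge0_integral_radial n (v : 'rV[R]_n.+1) (g : RT * RT -> \bar R) :
  measurable_fun setT g -> (forall p, 0 <= g p)%E ->
  (\int[lebesgue_tuple n.+1]_w
     g (dot v (row_of_tuple w), sqn (row_of_tuple w)) =
   \int[lebesgue_tuple n.+1]_w
     g (Num.sqrt (sqn v) * row_of_tuple w 0%R ord0, sqn (row_of_tuple w))%R)%E.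
Proof.
have mD n' (u : 'rV[R]_n'.+1) h : measurable_fun setT h -> measurable_fun setT
    (fun w : n'.+1.-tuple RT => h (dot u (row_of_tuple w), sqn (row_of_tuple w)) : \bar R).
  move=> mh; apply: measurableT_comp => //; apply: measurable_fun_pair.
    exact: measurable_dot.
  exact: measurable_sqn.
have mC n' (a : R) h : measurable_fun setT h -> measurable_fun setT
    (fun w : n'.+1.-tuple RT =>
       h (a * row_of_tuple w 0 ord0, sqn (row_of_tuple w)) : \bar R).
  move=> mh; apply: measurableT_comp => //; apply: measurable_fun_pair.
    by apply: measurable_funM => //; exact: measurable_row_coord.
  exact: measurable_sqn.
elim: n v g => [|n IH] v g mg g0;
  apply: (etrans (ge0_integral_lebesgue_tupleS (mD _ v _ mg) (fun=> g0 _)));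
  apply: (etrans _ (esym (ge0_integral_lebesgue_tupleS
    (mC _ (Num.sqrt (sqn v)) _ mg) (fun=> g0 _)))).
  (* In dimension 0 the measure is the Dirac mass at the empty tuple, of total mass 1. *)
  have E0 c : (\int[lebesgue_tuple 0]_w c = c :> \bar R)%E.
    by rewrite integral_cst//; apply: (etrans _ (mule1 _)); congr (_ * _)%E; exact: diracT.
  have nil0 (u : 'rV[R]_0) : sqn u = 0 by rewrite /sqn big_ord0.
  have dot0 (u : 'rV[R]_0) (w : 0.-tuple RT) : dot u (row_of_tuple w) = 0.
    by rewrite /dot big_ord0.
  rewrite sqn_tail nil0 addr0 sqrtr_sqr.
  transitivity (\int[leb]_x g (v 0%R ord0 * x, x ^+ 2)%R)%E.
    apply: eq_integral => x _; rewrite -[RHS]E0.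
    by apply: eq_integral => w _; rewrite dot_tcons sqn_tcons dot0 nil0 !addr0.
  rewrite (ge0_integral_abs_scale _ mg g0).
  apply: eq_integral => x _; rewrite -[LHS]E0.
  by apply: eq_integral => w _; rewrite sqn_tcons nil0 addr0 row_of_tuple_tcons0.
(* All coordinates after the first two are integrated out, which leaves an integrand on the
   plane. *)
pose G (p : RT * RT) : \bar R :=
  (\int[lebesgue_tuple n]_w g (p.1, p.2 + sqn (row_of_tuple w))%R)%E.
have mG : measurable_fun setT G.
  apply: (measurable_fun_fubini_tonelli_F
    (fun q : (RT * RT) * n.-tuple RT => g (q.1.1, q.1.2 + sqn (row_of_tuple q.2))%R)) => //.
  apply: measurableT_comp => //; apply: measurable_fun_pair => //=.
    exact: (measurableT_comp measurable_fst measurable_fst).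
  apply: measurable_funD.
    exact: (measurableT_comp measurable_snd measurable_fst).
  apply: (@measurableT_comp _ _ _ _ _ _ (fun w : n.-tuple RT => sqn (row_of_tuple w)) _ _ _).
    exact: measurable_sqn.
  exact: measurable_snd.
have G0 p : (0 <= G p)%E by apply: integral_ge0 => w _; exact: g0.
have sqrt_tail : Num.sqrt (sqn v) =
    Num.sqrt (v 0 ord0 ^+ 2 + Num.sqrt (sqn (tail_row v)) ^+ 2).
  by rewrite sqr_sqrtr ?sqn_ge0// -sqn_tail.
apply: (etrans _ (etrans (ge0_integral_plane_radial (v 0 ord0)
  (Num.sqrt (sqn (tail_row v))) mG G0) _)); last first.
  rewrite -sqrt_tail; apply: eq_integral => x _.
  pose h (p : RT * RT) := g (Num.sqrt (sqn v) * x, x ^+ 2 + p.2).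
  have mh : measurable_fun setT h.
    apply: measurableT_comp => //; apply: measurable_fun_pair => //=.
    exact: measurable_funD.
  (* [h] ignores its first argument; the coefficient 0 only gives the integrand the shape covered by
     [mC]. *)
  transitivity (\int[lebesgue_tuple n.+1]_w
      h (0 * row_of_tuple w 0%R ord0, sqn (row_of_tuple w))%R)%E.
    apply/esym/(etrans (ge0_integral_lebesgue_tupleS (mC _ 0 _ mh) (fun=> g0 _))).
    apply: eq_integral => y _; apply: eq_integral => w _.
    by rewrite /h/= sqn_tcons addrA.
  by apply: eq_integral => w _; rewrite /h/= row_of_tuple_tcons0 sqn_tcons.
apply: eq_integral => x _.
pose h (p : RT * RT) := g (v 0 ord0 * x + p.1, x ^+ 2 + p.2).
have mh : measurable_fun setT h.
  apply: measurableT_comp => //; apply: measurable_fun_pair => /=; exact: measurable_funD.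
transitivity (\int[lebesgue_tuple n.+1]_w
    h (dot (tail_row v) (row_of_tuple w), sqn (row_of_tuple w)))%E.
  by apply: eq_integral => w _; rewrite /h/= dot_tcons sqn_tcons.
apply: (etrans (IH (tail_row v) h mh (fun=> g0 _))).
apply: (etrans (ge0_integral_lebesgue_tupleS (mC _ _ _ mh) (fun=> g0 _))).
apply: eq_integral => y _; apply: eq_integral => w _.
by rewrite /h/= row_of_tuple_tcons0 !sqn_tcons addrA.
Qed.

End radial.

(** * Radial integrals and their scaling *)

Section radial_moments.
Context {R : realType}.
Local Notation RT := (measurableTypeR R).
Local Notation leb := (@lebesgue_measure R).

Definition radint n (h : RT -> \bar R) : \bar R :=
  (\int[lebesgue_tuple n]_w h (sqn (row_of_tuple w)))%E.

Lemma measurable_comp_sqn n (h : RT -> \bar R) : measurable_fun setT h ->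
  measurable_fun setT (fun w : n.-tuple RT => h (sqn (row_of_tuple w))).
Proof.
move=> mh; apply: (@measurableT_comp _ _ _ _ _ _ h) => //; exact: measurable_sqn.
Qed.

Lemma radint_ge0 n h : (forall q, 0 <= h q)%E -> (0 <= radint n h)%E.
Proof. by move=> h0; apply: integral_ge0 => w _; exact: h0. Qed.

Lemma radintZ n (c : R) (f : RT -> \bar R) : 0 <= c ->
  measurable_fun setT f -> (forall q, 0 <= f q)%E ->
  radint n (fun q => c%:E * f q)%E = (c%:E * radint n f)%E.
Proof.
by move=> c0 mf f0; rewrite /radint ge0_integralZl//; exact: measurable_comp_sqn.
Qed.

Lemma radintS n (h : RT -> \bar R) : measurable_fun setT h ->
  (forall q, 0 <= h q)%E ->
  radint n.+1 h = (\int[leb]_x radint n (fun q => h (x ^+ 2 + q)%R))%E.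
Proof.
move=> mh h0.
apply: (etrans (ge0_integral_lebesgue_tupleS (measurable_comp_sqn mh) (fun=> h0 _))).
by apply: eq_integral => x _; apply: eq_integral => w _; rewrite sqn_tcons.
Qed.

Lemma measurable_radint_shift n (h : RT -> \bar R) : measurable_fun setT h ->
  (forall q, 0 <= h q)%E ->
  measurable_fun setT (fun x : RT => radint n (fun q => h (x ^+ 2 + q)%R)).
Proof.
move=> mh h0.
apply: (measurable_fun_fubini_tonelli_F
  (fun p : RT * n.-tuple RT => h (p.1 ^+ 2 + sqn (row_of_tuple p.2))%R)) => //.
apply: measurableT_comp => //; apply: measurable_funD; first exact: measurable_funX.
apply: (@measurableT_comp _ _ _ _ _ _ (fun w : n.-tuple RT => sqn (row_of_tuple w)) _ _ _).
  exact: measurable_sqn.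
exact: measurable_snd.
Qed.

(** Each coordinate contributes one factor r through the one-dimensional change of variable. *)
Lemma radint_scale n (r : R) (h : RT -> \bar R) : 0 < r ->
  measurable_fun setT h -> (forall q, 0 <= h q)%E ->
  radint n h = ((r ^+ n)%:E * radint n (fun q => h (r ^+ 2 * q)%R))%E.
Proof.
move=> r0; elim: n h => [|n IH] h mh h0.
  rewrite expr0 mul1e; apply: eq_integral => w _.
  by rewrite /sqn big_ord0 mulr0.
have mr : measurable_fun setT (fun q : RT => h (r ^+ 2 * q)).
  by apply: measurableT_comp => //; exact: measurable_funM.
have madd x : measurable_fun setT (fun q : RT => h (x + q)).
  by apply: measurableT_comp => //; exact: measurable_funD.
rewrite (radintS _ mh h0) (radintS _ mr (fun=> h0 _)).
apply: (etrans (ge0_integral_affine 0 r0 (measurable_radint_shift n mh h0) _)).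
  by move=> x; exact: radint_ge0.
rewrite exprS EFinM -muleA; congr (_ * _)%E.
rewrite -ge0_integralZl//; last 3 first.
- exact: (measurable_radint_shift n mr (fun=> h0 _)).
- by move=> x _; exact: radint_ge0.
- by rewrite lee_fin exprn_ge0// ltW.
apply: eq_integral => x _; rewrite addr0 (IH _ (madd _) (fun=> h0 _)).
by congr (_ * _)%E; apply: eq_integral => w _; rewrite mulrDr exprMn.
Qed.

(* Only used at q = |w|^2; the absolute value makes it nonnegative on all of R. *)
Definition rker (k : nat) (b q : R) : R := `|q| ^+ k / Num.sqrt q `^ b.

Lemma rker_ge0 k b q : 0 <= rker k b q.
Proof. by rewrite divr_ge0 ?exprn_ge0 ?powR_ge0. Qed.

Lemma measurable_sqrt : measurable_fun setT (Num.sqrt : RT -> RT).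
Proof. by apply: continuous_measurable_fun; exact: sqrt_continuous. Qed.

Lemma measurable_rker k b : measurable_fun setT (rker k b : RT -> RT).
Proof.
apply: measurable_funM; first by apply: measurable_funX; exact: normr_measurable.
rewrite (_ : (fun _ => _) = (fun q : RT => Num.sqrt q `^ (- b))); last first.
  by apply/funext => q; rewrite powRN.
apply: (@measurableT_comp _ _ _ _ _ _ (@powR R ^~ (- b))) => //.
exact: measurable_sqrt.
Qed.

Lemma rker_scale k b (r q : R) : 0 < r ->
  rker k b (r ^+ 2 * q) = r `^ (k.*2%:R - b) * rker k b q.
Proof.
move=> r0; rewrite /rker normrM exprMn sqrtrM ?sqr_ge0// sqrtr_sqr.
rewrite (gtr0_norm r0) gtr0_norm ?exprn_gt0// powRM ?sqrtr_ge0 ?(ltW r0)//.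
rewrite powRB ?(gt_eqF r0) ?implybT// powR_mulrn ?(ltW r0)// -exprM mul2n invfM.
by rewrite mulrACA.
Qed.

(** The exponent adds the n of the Jacobian to the degree 2k - b of the kernel. *)
Lemma radint_rker_scale n k b (r : R) (phi : RT -> R) : 0 < r ->
  measurable_fun setT phi -> (forall q, 0 <= phi q) ->
  radint n (fun q => (rker k b q * phi q)%:E) =
  ((r `^ ((n + k.*2)%:R - b))%:E *
    radint n (fun q => (rker k b q * phi (r ^+ 2 * q))%:E))%E.
Proof.
move=> r0 mphi phi0.
have m1 : measurable_fun setT (fun q : RT => (rker k b q * phi q)%:E).
  by apply/measurable_EFinP; apply: measurable_funM => //; exact: measurable_rker.
have m2 : measurable_fun setT (fun q : RT => (rker k b q * phi (r ^+ 2 * q))%:E).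
  apply/measurable_EFinP; apply: measurable_funM; first exact: measurable_rker.
  by apply: measurableT_comp => //; exact: measurable_funM.
have p1 q : (0 <= (rker k b q * phi q)%:E)%E by rewrite lee_fin mulr_ge0 ?rker_ge0.
have p2 q : (0 <= (rker k b q * phi (r ^+ 2 * q))%:E)%E.
  by rewrite lee_fin mulr_ge0 ?rker_ge0.
rewrite (radint_scale n r0 m1 p1).
have -> : r `^ ((n + k.*2)%:R - b) = r ^+ n * r `^ (k.*2%:R - b).
  have -> : (n + k.*2)%:R - b = n%:R + (k.*2%:R - b) by rewrite natrD addrA.
  by rewrite powRD ?(gt_eqF r0) ?implybT// powR_mulrn ?(ltW r0).
rewrite EFinM -muleA; congr (_ * _)%E.
apply: (etrans _ (radintZ _ (powR_ge0 _ _) m2 p2)).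
rewrite /radint; apply: eq_integral => w _; rewrite rker_scale// -EFinM.
by congr EFin; rewrite -mulrA.
Qed.

End radial_moments.

(** * Positivity and finiteness of the radial moments *)

Section radial_moments_recursion.
Context {R : realType}.
Local Notation RT := (measurableTypeR R).

(** The threshold t bounds |w|^2, so it is the square of the radius. The value stays extended-real
    until finiteness is known. *)
Definition radmom n k b t : \bar R :=
  radint n (fun q => (rker k b q * \1_(`]-oo, t[%classic : set RT) q)%:E).

Arguments radmom n%_N k%_N b%_R t%_R.

Lemma indic_itv (i : interval R) (q : R) :
  \1_([set` i] : set RT) q = (q \in i)%:R :> R.
Proof. by rewrite indicE; congr (_ : bool)%:R; apply/idP/idP; rewrite inE. Qed.

Lemma rker00 (q : R) : rker 0 0 q = 1.
Proof. by rewrite /rker powRr0 expr0 divr1. Qed.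

Lemma rkerS k b (q : R) : 0 <= q -> rker k.+1 b q = q * rker k b q.
Proof. by move=> q0; rewrite /rker exprS ger0_norm// mulrA. Qed.

Lemma rkerS0 k b : rker k.+1 b (0 : R) = 0.
Proof. by rewrite rkerS// mul0r. Qed.

Lemma measurable_rker_indic k b (A : set RT) : measurable A ->
  measurable_fun setT (fun q : RT => (rker k b q * \1_A q)%:E).
Proof.
move=> mA; apply/measurable_EFinP; apply: measurable_funM.
  exact: measurable_rker.
exact: measurable_indic.
Qed.

Lemma rker_indic_ge0 k b (A : set RT) q : (0 <= (rker k b q * \1_A q)%:E)%E.
Proof. by rewrite lee_fin mulr_ge0// rker_ge0. Qed.

Lemma le_radint n (f g : RT -> \bar R) :
  measurable_fun setT f -> measurable_fun setT g -> (forall q, 0 <= f q)%E ->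
  (forall q, (0 <= q)%R -> (f q <= g q)%E) -> (radint n f <= radint n g)%E.
Proof.
move=> mf mg f0 fg; apply: ge0_le_integral => //.
- exact: measurable_comp_sqn.
- exact: measurable_comp_sqn.
- by move=> w _; apply: fg; exact: sqn_ge0.
Qed.

Lemma eq_radint n (f g : RT -> \bar R) : (forall q, 0 <= q -> f q = g q) ->
  radint n f = radint n g.
Proof. by move=> fg; apply: eq_integral => w _; rewrite fg// sqn_ge0. Qed.

Lemma radintD n (f g : RT -> \bar R) :
  measurable_fun setT f -> measurable_fun setT g ->
  (forall q, 0 <= f q)%E -> (forall q, 0 <= g q)%E ->
  radint n (fun q => f q + g q)%E = (radint n f + radint n g)%E.
Proof.
by move=> mf mg f0 g0; rewrite /radint ge0_integralD//; exact: measurable_comp_sqn.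
Qed.

Lemma measurable_sqn_preimage n (A : set RT) : measurable A ->
  measurable [set w : n.-tuple RT | A (sqn (row_of_tuple w))].
Proof. by move=> mA; rewrite -[X in measurable X]setTI; exact: measurable_sqn. Qed.

Lemma radint_indic n (A : set RT) : measurable A ->
  radint n (fun q => (rker 0 0 q * \1_A q)%:E) =
  lebesgue_tuple n [set w | A (sqn (row_of_tuple w))].
Proof.
move=> mA; rewrite -[X in lebesgue_tuple n X]setIT -integral_indic//.
  by apply: eq_integral => w _; rewrite rker00 mul1r.
exact: measurable_sqn_preimage.
Qed.

Lemma measurable_box n (A : set RT) : measurable A ->
  measurable [set w : n.-tuple RT | forall i, A (tnth w i)].
Proof.
move=> mA.
rewrite (_ : mkset _ =
    \bigcap_(i in setT) ((fun w : n.-tuple RT => tnth w i) @^-1` A)).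
  apply: fin_bigcap_measurable => // i _.
  by rewrite -[X in measurable X]setTI; exact: measurable_tnth.
by apply/seteqP; split=> w /= Aw i; [move=> _|]; exact: Aw.
Qed.

Lemma prode_const_EFin n (c : R) : (\prod_(i < n) c%:E = (c ^+ n)%:E)%E.
Proof.
by elim: n => [|n IH]; rewrite ?big_ord0 ?expr0// big_ord_recl IH -EFinM exprS.
Qed.

(** The unit ball lies in the cube of side 2 centred at the origin. *)
Lemma ball_volume_lty n : (radmom n 0 0 1%R < +oo)%E.
Proof.
rewrite /radmom radint_indic//.
pose I : set RT := `[-1, 1]%classic.
pose box := [set w : n.-tuple RT | forall i, I (tnth w i)].
have mbox : measurable box by apply: measurable_box; exact: measurable_itv.
apply: (@le_lt_trans _ _ (lebesgue_tuple n box)).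
  apply: le_measure.
  - by rewrite inE; exact: measurable_sqn_preimage.
  - by rewrite inE.
  move=> w /=; rewrite in_itv/= => qw i; rewrite /I /= in_itv/=.
  rewrite -ler_norml -(@expr_le1 _ 2)// real_normK ?num_real//.
  rewrite (le_trans _ (ltW qw))// /sqn (bigD1 i)//= mxE lerDl.
  by apply: sumr_ge0 => j _; exact: sqr_ge0.
rewrite (@lebesgue_tuple_box R n (fun=> I)) => [|i]; last exact: measurable_itv.
rewrite /I lebesgue_measure_itv/= lte_fin.
by rewrite gtrN// -EFinB prode_const_EFin ltry.
Qed.

Lemma ball_volume_gt0 n : (0 < radmom n 0 0 1%R)%E.
Proof.
rewrite /radmom radint_indic//.
(* Half the side of a cube inside the ball: as e <= 1, each squared coordinate is at most e, and n e
   < 1. *)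
pose e : R := n.+1%:R^-1.
have e0 : 0 < e by rewrite invr_gt0.
have e1 : e <= 1 by rewrite invf_le1// ler1n.
pose I : set RT := `]- e, e[%classic.
pose box := [set w : n.-tuple RT | forall i, I (tnth w i)].
have mbox : measurable box by apply: measurable_box; exact: measurable_itv.
apply: (@lt_le_trans _ _ (lebesgue_tuple n box)); last first.
  apply: le_measure.
  - by rewrite inE.
  - by rewrite inE; exact: measurable_sqn_preimage.
  move=> w /= bw; rewrite in_itv/=.
  apply: (@le_lt_trans _ _ (\sum_(i < n) e)).
    apply: ler_sum => i _; rewrite mxE.
    have := bw i; rewrite /I /= in_itv/= -ltr_norml => wi.
    rewrite -real_normK ?num_real// expr2 (le_trans _ (ltW wi))//.
    by rewrite ler_piMr// (le_trans (ltW wi)).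
  by rewrite sumr_const card_ord -mulr_natl /e ltr_pdivrMr// mul1r ltr_nat.
rewrite (@lebesgue_tuple_box R n (fun=> I)) => [|i]; last exact: measurable_itv.
rewrite /I lebesgue_measure_itv/= lte_fin.
by rewrite gtrN// -EFinB prode_const_EFin lte_fin exprn_gt0// opprK addr_gt0.
Qed.

Lemma radmom_scale n k b (r : R) : 0 < r ->
  radmom n k b (r ^+ 2) = ((r `^ ((n + k.*2)%:R - b))%:E * radmom n k b 1%R)%E.
Proof.
move=> r0; rewrite /radmom (radint_rker_scale n k b r0)//.
congr (_ * _)%E; apply: eq_radint => q q0; congr (_ * _)%:E.
rewrite !indicE; congr (_ : bool)%:R; apply/idP/idP; rewrite !inE /= !in_itv/=.
  by rewrite gtr_pMr// exprn_gt0.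
by rewrite gtr_pMr// exprn_gt0.
Qed.

(** Here 1/2 <= sqrt q <= 1, and c <= |c| makes the power with exponent |c| the smaller one; this
    gives one lower bound for both signs of c. *)
Lemma shell_powR (c q : R) : 4^-1 <= q <= 1 -> 2^-1 `^ `|c| <= Num.sqrt q `^ c.
Proof.
move=> /andP[q4 q1].
have s2 : 2^-1 <= Num.sqrt q.
  rewrite -(@ler_sqr _ _ _) ?nnegrE ?sqrtr_ge0// sqr_sqrtr; last by lra.
  by rewrite expr2 -invfM -natrM.
have s1 : Num.sqrt q <= 1 by rewrite -sqrtr1 ler_sqrt.
apply: (@le_trans _ _ (Num.sqrt q `^ `|c|)).
  by apply: ge0_ler_powR; rewrite ?nnegrE ?sqrtr_ge0.
apply: ger_powR; last exact: ler_norm.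
by rewrite s1 (lt_le_trans _ s2).
Qed.

Definition shell (a : R) : set RT := `[a, 1[%classic.

Definition shellmom n k b a : \bar R :=
  radint n (fun q => (rker k b q * \1_(shell a) q)%:E).

Arguments shellmom n%_N k%_N b%_R a%_R.

(** The ball of radius 1/2 has 2^-n times the volume V of the unit ball. A null shell would give V =
    2^-n V, impossible for 0 < V < oo and n > 0. *)
Lemma shell_volume_gt0 n : (0 < n)%N -> (0 < shellmom n 0 0 4^-1)%E.
Proof.
move=> n0.
have split : radmom n 0 0 1 = (radmom n 0 0 4^-1 + shellmom n 0 0 4^-1)%E.
  rewrite /radmom /shellmom -radintD.
  - apply: eq_radint => q q0; rewrite -EFinD !rker00 !mul1r; congr EFin.

    rewrite /shell !indic_itv !in_itv/= -natrD; congr _%:R.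
    by case: (ltP q 1) => q1; case: (ltP q 4^-1) => q4 //; exfalso; lra.
  - exact: measurable_rker_indic.
  - by apply: measurable_rker_indic; exact: measurable_itv.
  - by move=> q; exact: rker_indic_ge0.
  - by move=> q; exact: rker_indic_ge0.
have sc : radmom n 0 0 4^-1 = ((2^-1 ^+ n)%:E * radmom n 0 0 1)%E.
  have -> : 4^-1 = 2^-1 ^+ 2 :> R by rewrite expr2 -invfM -natrM.
  by rewrite radmom_scale// addn0 subr0 powR_mulrn.
have V0 := ball_volume_gt0 n; have V1 := ball_volume_lty n.
rewrite lt_def radint_ge0 ?andbT; last by move=> q; exact: rker_indic_ge0.
apply/eqP => s0; move: split; rewrite sc s0 adde0.
case: (radmom n 0 0 1) V0 V1 => [v| |]//; rewrite lte_fin -EFinM => v0 _ [] /eqP.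
rewrite eq_sym -subr_eq0 -{2}[v]mul1r -mulrBl mulf_eq0 (gt_eqF v0) orbF subr_eq0.
by rewrite lt_eqF// exprn_ilt1 ?invr_ge0 ?invf_lt1 ?ltr1n// -lt0n.
Qed.

(** Away from the origin the kernel is bounded below: q^k >= 4^-k and (sqrt q)^-b >= 2^-|b| on the
    shell, whose volume is positive. *)
Lemma shellmom_gt0 n k b : (0 < n)%N -> (0 < shellmom n k b 4^-1)%E.
Proof.
move=> n0; pose c : R := 4^-1 ^+ k * 2^-1 `^ `|- b|.
have c0 : 0 < c by rewrite mulr_gt0 ?exprn_gt0 ?powR_gt0.
have mI : measurable (shell 4^-1) by exact: measurable_itv.
apply: (@lt_le_trans _ _ (c%:E * shellmom n 0 0 4^-1)%E).
  by rewrite mule_gt0 ?lte_fin// shell_volume_gt0.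
rewrite -radintZ ?(ltW c0)//; last 2 first.
- exact: measurable_rker_indic.
- by move=> q; exact: rker_indic_ge0.
apply: le_radint.
- by apply: measurable_funeM; exact: measurable_rker_indic.
- exact: measurable_rker_indic.
- by move=> q; rewrite mule_ge0 ?rker_indic_ge0// lee_fin ltW.
move=> q q0; rewrite rker00 mul1r -EFinM lee_fin.
rewrite indicE; case: (boolP (q \in _)); rewrite ?mulr0// !mulr1 inE /shell/= in_itv/=.
move=> /andP[q4 q1]; rewrite /rker -powRN ler_pM ?exprn_ge0 ?powR_ge0//.
  by rewrite lerXn2r ?nnegrE// (le_trans q4)// ler_norm.
by apply: shell_powR; rewrite q4 ltW.
Qed.

(** On the shell the kernel is at most 2^|b|, so the volume of the ball bounds the moment. *)
Lemma shellmom_lty n k b : (shellmom n k b 4^-1 < +oo)%E.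
Proof.
pose c : R := (2^-1 `^ `|b|)^-1.
have c0 : 0 < c by rewrite invr_gt0 powR_gt0.
have mI : measurable (shell 4^-1) by exact: measurable_itv.
apply: (@le_lt_trans _ _ (c%:E * radmom n 0 0 1)%E); last first.
  by rewrite lte_mul_pinfty ?lee_fin ?(ltW c0)// ball_volume_lty.
rewrite -radintZ ?(ltW c0)//; last 2 first.
- exact: measurable_rker_indic.
- by move=> q; exact: rker_indic_ge0.
apply: le_radint.
- exact: measurable_rker_indic.
- by apply: measurable_funeM; exact: measurable_rker_indic.
- by move=> q; exact: rker_indic_ge0.
move=> q q0; rewrite rker00 mul1r -EFinM lee_fin !indicE.
have [|] := boolP (q \in shell _); last first.
  by rewrite mulr0 mulr_ge0// ltW.
rewrite inE /shell/= in_itv/= => /andP[q4 q1].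
rewrite mem_set/= ?in_itv//= !mulr1 /rker -[leRHS]mul1r.
rewrite ler_pM ?exprn_ge0 ?invr_ge0 ?powR_ge0//.
  by rewrite exprn_ile1// ger0_norm// ltW.
by rewrite lef_pV2 ?posrE ?powR_gt0 ?sqrtr_gt0 ?(lt_le_trans _ q4)// shell_powR// q4 ltW.
Qed.

Lemma half_powR_lt1 (a : R) : 0 < a -> 2^-1 `^ a < 1.
Proof.
move=> a0; have := @gt0_ltr_powR R a a0 2^-1 1.
rewrite powR1; apply; rewrite ?nnegrE//.
by rewrite invf_lt1// ltr1n.
Qed.

(* Scaling by 1/2 maps a dyadic shell to the next one, so the truncated moments
   satisfy X_(j+1) = X_1 + rho X_j with rho < 1. *)
Lemma shellmom_le n k b j : (0 < (n + k.*2)%:R - b) ->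
  (shellmom n k b (4^-1 ^+ j) <=
    ((1 - 2^-1 `^ ((n + k.*2)%:R - b))^-1)%:E * shellmom n k b 4^-1)%E.
Proof.
move=> a0; set rho := _ `^ _.
have rho0 : 0 < rho by rewrite powR_gt0.
have rho1 : rho < 1 by exact: half_powR_lt1.
have S0 a : (0 <= shellmom n k b a)%E.
  by apply: radint_ge0 => q; exact: rker_indic_ge0.
have mi (i : interval R) : measurable ([set` i] : set RT) by exact: measurable_itv.
elim: j => [|j IH].
  (* For j = 0 the shell is [[1, 1[], which is empty. *)
  rewrite [leLHS](_ : _ = 0%E) ?mule_ge0// ?lee_fin ?invr_ge0 ?subr_ge0 ?ltW//.
  apply: integral0_eq => w _; rewrite /shell expr0 indic_itv in_itv/=.
  by case: (leP 1 (sqn _)); rewrite /= mulr0.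
have -> : shellmom n k b (4^-1 ^+ j.+1) =
    (shellmom n k b 4^-1 + rho%:E * shellmom n k b (4^-1 ^+ j))%E.
  have -> : (rho%:E * shellmom n k b (4^-1 ^+ j))%E =
      radint n (fun q => (rker k b q * \1_(`[4^-1 ^+ j.+1, 4^-1[%classic : set RT) q)%:E).
    have h0 : 0 < 2^-1 :> R by rewrite invr_gt0.
    have mJ := measurable_indic (mi `[4^-1 ^+ j.+1, 4^-1[).
    rewrite (radint_rker_scale n k b h0 (mJ _ _)) => [|q]; last by rewrite indicE.
    congr (_ * _)%E; apply: eq_radint => q q0; congr (_ * _)%:E.
    rewrite /shell !indic_itv !in_itv/=.
    have -> : 2^-1 ^+ 2 = 4^-1 :> R by rewrite expr2 -invfM -natrM.
    by rewrite exprS ler_pM2l ?invr_gt0// gtr_pMr ?invr_gt0.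
  rewrite /shellmom -radintD; last 4 first.
  - by apply: measurable_rker_indic; exact: mi.
  - by apply: measurable_rker_indic; exact: mi.
  - by move=> q; exact: rker_indic_ge0.
  - by move=> q; exact: rker_indic_ge0.
  apply: eq_radint => q q0; rewrite -EFinD -mulrDr; congr (_ * _)%:E.
  rewrite /shell !indic_itv !in_itv/= -natrD; congr _%:R.
  have p1 : 4^-1 ^+ j.+1 <= 4^-1 :> R.
    by rewrite exprS ler_piMr// exprn_ile1// invf_le1// ler1n.
  by case: (ltP q 1) => q1; case: (leP 4^-1 q) => q4;
    case: (leP (4^-1 ^+ j.+1) q) => qj //; exfalso; lra.
have := shellmom_lty n k b; move: (S0 4^-1) IH.
case: (shellmom n k b 4^-1) => [s| |]// s0 IH _.
(* The bound s / (1 - rho) is the fixed point of X |-> s + rho X, so it survives the recursion. *)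
apply: (@le_trans _ _ (s%:E + rho%:E * ((1 - rho)^-1%:E * s%:E))%E).
  by rewrite leeD2l// lee_wpmul2l// lee_fin ltW.
rewrite -!EFinM -EFinD lee_fin le_eqVlt; apply/orP; left; apply/eqP.
by field; rewrite subr_eq0 gt_eqF.
Qed.

(** Monotone convergence along the shells 4^-j <= |w|^2 < 1, which exhaust the punctured ball and
    whose moments share one bound. *)
Lemma radmom_lty n k b : (0 < k)%N -> 0 < (n + k.*2)%:R - b ->
  (radmom n k b 1 < +oo)%E.
Proof.
move=> k0 a0; set rho := 2^-1 `^ ((n + k.*2)%:R - b).
pose F j : set (n.-tuple RT) := [set w | shell (4^-1 ^+ j) (sqn (row_of_tuple w))].
have mF j : measurable (F j).
  by apply: measurable_sqn_preimage; exact: measurable_itv.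
pose f (w : n.-tuple RT) := (rker k b (sqn (row_of_tuple w)))%:E.
have mf : measurable_fun setT f.
  have mh : measurable_fun setT (fun q : RT => (rker k b q)%:E).
    by apply/measurable_EFinP; exact: measurable_rker.
  exact: (measurable_comp_sqn mh).
have FE j : (\int[lebesgue_tuple n]_(w in F j) f w = shellmom n k b (4^-1 ^+ j))%E.
  rewrite integral_mkcond; apply: eq_integral => w _.
  rewrite patchE /f indicE (_ : (w \in F j) = (sqn (row_of_tuple w) \in shell (4^-1 ^+ j))).
    by case: ifPn; rewrite ?mulr1 ?mulr0.
  by apply/idP/idP; rewrite !inE.
have ndF : nondecreasing_seq F.
  move=> i j ij; apply/subsetPset => w; rewrite /F /shell /= !in_itv/= => /andP[wi ->].
  by rewrite andbT (le_trans _ wi)// ler_wiXn2l// invf_le1// ler1n.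
have := @ge0_nondecreasing_set_cvg_integral _ _ _ F f (lebesgue_tuple n) ndF mF
  (fun i => measurable_funTS mf) (fun _ _ _ => rker_ge0 _ _ _).
rewrite (_ : (fun i => _) = fun j => shellmom n k b (4^-1 ^+ j)); last first.
  by apply/funext => j; exact: FE.
move=> cvgF.
have -> : radmom n k b 1 = (\int[lebesgue_tuple n]_(w in \bigcup_i F i) f w)%E.
  rewrite [RHS]integral_mkcond; apply: eq_integral => w _.
  rewrite patchE /f indic_itv in_itv/=; set q := sqn _.
  have [q1|q1] := ltP q 1; rewrite ?mulr0 ?mulr1; last first.
    by rewrite memNset// => -[j _]; rewrite /F /shell/= in_itv/= -/q ltNge q1 andbF.
  (* The origin lies in no shell; as k > 0, the factor q^k makes the kernel vanish there whatever
     the weight evaluates to. *)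
  have [->|q0] := eqVneq q 0.
    by case: k k0 {a0 rho f mf FE cvgF} => [//|k] _; rewrite rkerS0; case: ifPn.
  have {}q0 : 0 < q by rewrite lt_def q0 sqn_ge0.
  have cv : (GRing.exp (4^-1 : R)) @ \oo --> (0 : R).
    by apply: cvg_expr; rewrite ger0_norm// invf_lt1// ltr1n.
  have [j _ /(_ j (leqnn j))/= jq] := cvgr_lt _ cv _ q0.
  by rewrite mem_set//; exists j => //; rewrite /F /shell/= in_itv/= -/q ltW.
rewrite -(cvg_lim _ cvgF)//.
apply: (@le_lt_trans _ _ (((1 - rho)^-1)%:E * shellmom n k b 4^-1)%E).
  apply: lime_le; first by apply/cvg_ex; eexists; exact: cvgF.
  by apply: nearW => j; exact: shellmom_le.
by rewrite lte_mul_pinfty ?shellmom_lty// lee_fin invr_ge0 subr_ge0 ltW// half_powR_lt1.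
Qed.

Lemma radmom_gt0 n k b : (0 < n)%N -> (0 < radmom n k b 1)%E.
Proof.
move=> n0; apply: (lt_le_trans (shellmom_gt0 k b n0)).
have mI : measurable (shell 4^-1) by exact: measurable_itv.
apply: le_radint.
- exact: measurable_rker_indic.
- exact: measurable_rker_indic.
- by move=> q; exact: rker_indic_ge0.
move=> q q0; rewrite lee_fin ler_wpM2l ?rker_ge0// !indicE ler_nat.
have [|//] := boolP (q \in shell _).
by rewrite inE /shell/= in_itv/= => /andP[_ q1]; rewrite mem_set//= in_itv.
Qed.

End radial_moments_recursion.
Arguments radmom {R} n%_N k%_N (b t)%_R.
Arguments shellmom {R} n%_N k%_N (b a)%_R.

(** * Recursion between consecutive radial moments *)

Section radial_moments_ratio.
Context {R : realType}.
Local Notation RT := (measurableTypeR R).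
Local Notation leb := (@lebesgue_measure R).

Lemma integral_powR01 (c : R) : 0 < c ->
  (\int[leb]_(t in `[0%R, 1%R]) (t `^ c)%:E = ((c + 1)^-1)%:E)%E.
Proof.
move=> c0.
have c1 : 0 < c + 1 by rewrite addr_gt0.
have cvg0 (a : R) : 0 < a -> x `^ a @[x --> 0^'+] --> (0 : R) `^ a.
  by move=> a0; rewrite powR0 ?gt_eqF//; exact: powR_cvg0.
have cts (a x : R) : 0 < x -> {for x, continuous (@powR R ^~ a)}.
  move=> x0; apply/differentiable_continuous/derivable1_diffP.
  by apply: derivable_powR; rewrite in_itv/= x0.
rewrite (@continuous_FTC2 _ (@powR R ^~ c) (fun t => (c + 1)^-1 * t `^ (c + 1)) 0 1)//.
- by rewrite powR1 powR0 ?gt_eqF// mulr0 mulr1 sube0.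
- apply/continuous_within_itvP => //; split.
  + by move=> x; rewrite in_itv/= => /andP[x0 _]; exact: cts.
  + exact: cvg0.
  + by apply: cvg_at_left_filter; exact: cts.
- split.
  + move=> x; rewrite in_itv/= => /andP[x0 _]; apply: derivableM => //.
    by apply: derivable_powR; rewrite in_itv/= x0.
  + by apply: cvgM; [exact: cvg_cst|exact: cvg0].
  + by apply: cvgM; [exact: cvg_cst|apply: cvg_at_left_filter; exact: cts].
- move=> x; rewrite in_itv/= => /andP[x0 _].
  rewrite derive1E deriveM//; last by apply: derivable_powR; rewrite in_itv/= x0.
  rewrite -(derive1E (@powR R ^~ _)) powR_derive1 ?in_itv/= ?x0// addrK.
  rewrite derive_cst scaler0 addr0.
  by rewrite /GRing.scale/= mulrA mulVf ?mul1r// gt_eqF.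
Qed.

(* Layer cake: integrate the indicator of |w|^2 < t over t in [0, 1]. *)
Lemma radmom_rec n k (b : R) : 0 < (n + k.*2)%:R - b ->
  (radmom n k b 1 = radmom n k.+1 b 1 +
    ((((n + k.*2)%:R - b) / 2 + 1)^-1)%:E * radmom n k b 1)%E.
Proof.
set a := _ - b => a0.
have mi (i : interval R) : measurable ([set` i] : set RT) by exact: measurable_itv.
(* On q < 1, write 1 = q + (1 - q): the first term raises the order of the moment. The second is the
   length of []q, 1]], so it is an integral over t of the indicator of q < t. *)
pose G (q : R) := rker k b q * Num.max 0 (1 - q).
have mG : measurable_fun setT (fun q : RT => (G q)%:E).
  apply/measurable_EFinP; apply: measurable_funM; first exact: measurable_rker.
  by apply: measurable_maxr => //; exact: measurable_funB.
have G0 q : (0 <= (G q)%:E)%E by rewrite lee_fin mulr_ge0 ?rker_ge0// le_max lexx.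
have E : radmom n k b 1 = (radmom n k.+1 b 1 + radint n (fun q => (G q)%:E))%E.
  rewrite /radmom -radintD//; last 2 first.
  - by apply: measurable_rker_indic; exact: mi.
  - by move=> q; exact: rker_indic_ge0.
  apply: eq_radint => q q0; rewrite -EFinD /G rkerS// !indic_itv !in_itv/=; congr EFin.
  have [q1|q1] := ltP q 1.
    by rewrite max_r ?subr_ge0 ?(ltW q1)// !mulr1 mulrBr mulr1 [q * _]mulrC addrC subrK.
  by rewrite max_l ?subr_le0// !mulr0 addr0.
rewrite {1}E; congr (_ + _)%E; clear E.
(* The condition |w|^2 < t is encoded as t - |w|^2 in []0, +oo[], which turns joint measurability
   into that of a composition. *)
pose F (p : n.-tuple RT * RT) : \bar R :=
  (rker k b (sqn (row_of_tuple p.1)) *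
   \1_(`]0, +oo[%classic : set RT) (p.2 - sqn (row_of_tuple p.1)) *
   \1_(`[0, 1]%classic : set RT) p.2)%:E.
have mq : measurable_fun setT (fun p : n.-tuple RT * RT => sqn (row_of_tuple p.1) : RT).
  apply: (@measurableT_comp _ _ _ _ _ _ (fun w : n.-tuple RT => sqn (row_of_tuple w)) _ _ _).
    exact: measurable_sqn.
  exact: measurable_fst.
have mF : measurable_fun setT F.
  apply/measurable_EFinP; apply: measurable_funM; first apply: measurable_funM.
  - by apply: (@measurableT_comp _ _ _ _ _ _ (rker k b : RT -> RT)) => //; exact: measurable_rker.
  - apply: (@measurableT_comp _ _ _ _ _ _ (\1_(`]0, +oo[%classic : set RT) : RT -> RT)).
      by apply: measurable_indic; exact: mi.
    by apply: measurable_funB.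
  - apply: (@measurableT_comp _ _ _ _ _ _ (\1_(`[0, 1]%classic : set RT) : RT -> RT)).
      by apply: measurable_indic; exact: mi.
    exact: measurable_snd.
have F0 p : (0 <= F p)%E by rewrite lee_fin !mulr_ge0 ?rker_ge0.
transitivity (\int[lebesgue_tuple n]_w \int[leb]_t F (w, t))%E.
  rewrite /radint; apply: eq_integral => w _; rewrite /F/=; set q := sqn _.
  have q0 : 0 <= q by exact: sqn_ge0.
  transitivity (\int[leb]_t ((rker k b q)%:E * (\1_(`]q, 1]%classic : set RT) t)%:E))%E.
    have mI : measurable_fun setT (fun t : RT => (\1_(`]q, 1]%classic : set RT) t)%:E : \bar R).
      by apply/measurable_EFinP; apply: measurable_indic; exact: measurable_itv.
    have k0 : (0 <= (rker k b q)%:E)%E by rewrite lee_fin rker_ge0.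
    rewrite (ge0_integralZl (lebesgue_measure) measurableT mI (fun _ _ => _) k0)//.
    rewrite integral_indic//.
    have L : leb (`]q, 1]%classic : set RT) = (Num.max 0 (1 - q))%:E.
      rewrite lebesgue_measure_itv/= lte_fin.
      have [q1|q1] := ltP q 1; first by rewrite max_r// subr_ge0 ltW.
      by rewrite max_l// subr_le0.
    rewrite setIT /G EFinM; congr (_ * _)%E; exact: (esym L).
  apply: eq_integral => t _; rewrite -EFinM; congr EFin; rewrite -mulrA; congr (_ * _).
  rewrite !indic_itv !in_itv/= subr_gt0 andbT -natrM mulnb; congr (_ : bool)%:R.
  by case: (ltP q t) => qt //=; rewrite (le_trans q0 (ltW qt)).
transitivity (\int[leb]_t \int[lebesgue_tuple n]_w F (w, t))%E.
  exact: (fubini_tonelli F mF F0).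
(* The moment over |w|^2 < t has degree a in the radius sqrt t, hence a / 2 in t; integrating this
   power gives the constant (a / 2 + 1)^-1. *)
transitivity (\int[leb]_(t in `[0%R, 1%R]) ((t `^ (a / 2))%:E * radmom n k b 1))%E.
  rewrite [RHS]integral_mkcond; apply: eq_integral => t _; rewrite patchE.
  case: ifPn => [/set_mem/= |]; rewrite ?in_itv/= => t01.
    transitivity (radmom n k b t).
      apply: eq_integral => w _; rewrite /F/= !indic_itv !in_itv/= subr_gt0 andbT.
      by rewrite t01 mulr1.
    have /andP[t0 _] := t01; move: t0; rewrite le_eqVlt => /predU1P[<-|t0].
      rewrite powR0 ?mul0e; last by rewrite gt_eqF// divr_gt0.
      apply: integral0_eq => w _; rewrite indic_itv in_itv/= ltNge sqn_ge0.
      by rewrite mulr0.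
    rewrite -[in LHS](sqr_sqrtr (ltW t0)) radmom_scale ?sqrtr_gt0//.
    by rewrite -powR12_sqrt ?(ltW t0)// -powRrM mulrC.
  by apply: integral0_eq => w _; rewrite /F/= [X in _ * X]indicE (negbTE t01) mulr0.
rewrite ge0_integralZr//; last 3 first.
- by apply/measurable_EFinP/measurable_funTS; exact: measurable_powR.
- by move=> t _; rewrite lee_fin powR_ge0.
- by apply: radint_ge0 => q; exact: rker_indic_ge0.
by rewrite integral_powR01 ?divr_gt0.
Qed.

End radial_moments_ratio.

(** * Integrals over the ball *)

Section ball_integrals.
Context {R : realType}.
Local Notation RT := (measurableTypeR R).
Variables (n : nat) (delta : R).
Hypothesis delta_gt0 : 0 < delta.
Implicit Types (F G : 'rV[R]_n -> R) (v : 'rV[R]_n).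

Definition row_measurable F :=
  measurable_fun setT (fun w : n.-tuple RT => F (row_of_tuple w) : RT).

Definition ball_integrable F :=
  (lebesgue_tuple n).-integrable [set w | enorm (row_of_tuple w) < delta]
    (fun w => (F (row_of_tuple w))%:E).

Lemma enorm_ltE v : (enorm v < delta) = (sqn v < delta ^+ 2).
Proof.
rewrite -[in LHS](gtr0_norm delta_gt0) -sqrtr_sqr /enorm ltr_sqrt// exprn_gt0//.
Qed.

Lemma enorm_sqr v : enorm v ^+ 2 = sqn v.
Proof. by rewrite sqr_sqrtr// sqn_ge0. Qed.

Lemma measurable_ball_tuple :
  measurable [set w : n.-tuple RT | enorm (row_of_tuple w) < delta].
Proof.
rewrite (_ : mkset _ = [set w : n.-tuple RT |
    `]-oo, (delta ^+ 2)[%classic (sqn (row_of_tuple w))]).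
  by apply: measurable_sqn_preimage; exact: measurable_itv.
by apply/seteqP; split=> w /=; rewrite in_itv/= enorm_ltE.
Qed.

Lemma row_measurableT_ball F : row_measurable F ->
  measurable_fun [set w : n.-tuple RT | enorm (row_of_tuple w) < delta]
    (fun w => (F (row_of_tuple w))%:E).
Proof. by move=> mF; apply/measurable_EFinP; exact: measurable_funTS. Qed.

Lemma eq_ball_integral F G : (forall v, enorm v < delta -> F v = G v) ->
  ball_integral delta F = ball_integral delta G.
Proof.
by move=> FG; apply: eq_Rintegral => w; rewrite inE/= => wd; rewrite FG.
Qed.

Lemma ball_integralD F G : ball_integrable F -> ball_integrable G ->
  ball_integral delta (fun v => F v + G v) =
  ball_integral delta F + ball_integral delta G.
Proof. by move=> iF iG; rewrite /ball_integral RintegralD//; exact: measurable_ball_tuple. Qed.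

Lemma ball_integralB F G : ball_integrable F -> ball_integrable G ->
  ball_integral delta (fun v => F v - G v) =
  ball_integral delta F - ball_integral delta G.
Proof. by move=> iF iG; rewrite /ball_integral RintegralB//; exact: measurable_ball_tuple. Qed.

Lemma ball_integralZ c F : ball_integrable F ->
  ball_integral delta (fun v => c * F v) = c * ball_integral delta F.
Proof. by move=> iF; rewrite /ball_integral RintegralZl//; exact: measurable_ball_tuple. Qed.

Lemma ball_integrableZ c F : ball_integrable F ->
  ball_integrable (fun v => c * F v).
Proof. by move=> iF; exact: (integrableZl measurable_ball_tuple c iF). Qed.

Lemma ball_integrableD F G : ball_integrable F -> ball_integrable G ->
  ball_integrable (fun v => F v + G v).
Proof. by move=> iF iG; exact: (integrableD measurable_ball_tuple iF iG). Qed.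

Lemma ball_integrableB F G : ball_integrable F -> ball_integrable G ->
  ball_integrable (fun v => F v - G v).
Proof. by move=> iF iG; exact: (integrableB measurable_ball_tuple iF iG). Qed.

(** Integrability and value are proved together, since additivity in the inductive step needs the
    integrability of the remaining sum. *)
Lemma ball_integral_sum (I : Type) (s : seq I) (F : I -> 'rV[R]_n -> R) :
  (forall i, ball_integrable (F i)) ->
  ball_integrable (fun v => \sum_(i <- s) F i v) /\
  ball_integral delta (fun v => \sum_(i <- s) F i v) =
  \sum_(i <- s) ball_integral delta (F i).
Proof.
move=> iF; elim: s => [|i s [IH1 IH2]].
  rewrite big_nil; under [X in ball_integral _ X]eq_fun do rewrite big_nil.
  split.
    under [X in ball_integrable X]eq_fun do rewrite big_nil.
    exact: integrable0.
  by rewrite /ball_integral /Rintegral integral0.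
split.
  under [X in ball_integrable X]eq_fun do rewrite big_cons.
  exact: ball_integrableD.
under [X in ball_integral _ X]eq_fun do rewrite big_cons.
by rewrite big_cons ball_integralD// IH2.
Qed.

Lemma le_ball_integral F G : ball_integrable F -> ball_integrable G ->
  (forall v, enorm v < delta -> F v <= G v) ->
  ball_integral delta F <= ball_integral delta G.
Proof.
move=> iF iG FG; apply: (le_Rintegral measurable_ball_tuple iF iG).
by move=> w; exact: FG.
Qed.

Lemma le_ball_integrable F G : row_measurable F -> ball_integrable G ->
  (forall v, enorm v < delta -> `|F v| <= G v) -> ball_integrable F.
Proof.
move=> mF iG FG; apply: (le_integrable measurable_ball_tuple _ _ iG).
  exact: row_measurableT_ball.
by move=> w /= wd; rewrite lee_fin (le_trans (FG _ wd))// ler_norm.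
Qed.

Lemma norm_ball_integral F G : row_measurable F -> ball_integrable G ->
  (forall v, enorm v < delta -> `|F v| <= G v) ->
  `|ball_integral delta F| <= ball_integral delta G.
Proof.
move=> mF iG FG; have iF := le_ball_integrable mF iG FG.
rewrite ler_norml -[X in - X]mul1r -mulNr -ball_integralZ//; apply/andP; split.
  apply: le_ball_integral => //; first exact: ball_integrableZ.
  by move=> v /FG; rewrite mulN1r; rewrite ler_norml => /andP[].
by apply: le_ball_integral => // v /FG; rewrite ler_norml => /andP[].
Qed.

End ball_integrals.

(** * Moments of the squared norm against the weight |v|^-b *)

Section weighted_moments.
Context {R : realType}.
Local Notation RT := (measurableTypeR R).
Variables (n : nat) (delta b : R).
Hypotheses (delta_gt0 : 0 < delta) (n_gt0 : (0 < n)%N) (b_lt : b < n%:R + 2).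
Implicit Types (F G : 'rV[R]_n -> R) (v : 'rV[R]_n).
Local Notation integrable := (ball_integrable delta).
Local Notation Int := (ball_integral delta).

Lemma row_measurable_coord i : row_measurable (fun v : 'rV[R]_n => v 0 i).
Proof. exact: measurable_row_coord. Qed.

Lemma row_measurable_dot u : row_measurable (fun v : 'rV[R]_n => dot u v).
Proof. exact: measurable_dot. Qed.

Lemma row_measurable_sqn : row_measurable (fun v : 'rV[R]_n => sqn v).
Proof. exact: measurable_sqn. Qed.

Lemma row_measurableM F G : row_measurable F -> row_measurable G ->
  row_measurable (fun v => F v * G v).
Proof. exact: measurable_funM. Qed.

Lemma row_measurableX F k : row_measurable F ->
  row_measurable (fun v => F v ^+ k).
Proof. exact: measurable_funX. Qed.

Lemma row_measurableD F G : row_measurable F -> row_measurable G ->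
  row_measurable (fun v => F v + G v).
Proof. exact: measurable_funD. Qed.

Lemma row_measurableB F G : row_measurable F -> row_measurable G ->
  row_measurable (fun v => F v - G v).
Proof. exact: measurable_funB. Qed.

Lemma row_measurableW : row_measurable (fun v : 'rV[R]_n => (enorm v `^ b)^-1).
Proof.
rewrite /row_measurable (_ : (fun _ => _) =
  (fun w : n.-tuple RT => rker 0 b (sqn (row_of_tuple w)))).
  apply: (@measurableT_comp _ _ _ _ _ _ (rker 0 b : RT -> RT)).
    exact: measurable_rker.
  exact: measurable_sqn.
by apply/funext => w; rewrite /rker expr0 mul1r.
Qed.

Definition sqnmom k := Int (fun v => sqn v ^+ k / enorm v `^ b).

Lemma integral_sqn_rad (k : nat) :
  (\int[lebesgue_tuple n]_(w in [set w | (enorm (row_of_tuple w) < delta)%R])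
     (sqn (row_of_tuple w) ^+ k / enorm (row_of_tuple w) `^ b)%R%:E =
   radmom n k b (delta ^+ 2))%E.
Proof.
rewrite integral_mkcond; apply: eq_integral => w _.
rewrite patchE indic_itv in_itv/= /rker (ger0_norm (sqn_ge0 _)).
rewrite (_ : (w \in _) = (sqn (row_of_tuple w) < delta ^+ 2)).
  by case: ifPn => _; rewrite ?mulr1 ?mulr0.
by rewrite -enorm_ltE//; apply/idP/idP; rewrite inE.
Qed.

(** With k = 0 the degree n - b may be nonpositive and the moment infinite; this is the source of
    the condition 0 < k on the moments below. *)
Let exp_gt0 k : (0 < k)%N -> 0 < (n + k.*2)%:R - b.
Proof.
case: k => // k _; rewrite subr_gt0 (lt_le_trans b_lt)// natrD lerD2l.
by rewrite doubleS (ler_nat _ 2).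
Qed.

Lemma radmom_ball_lty k : (0 < k)%N -> (radmom n k b (delta ^+ 2) < +oo)%E.
Proof.
move=> k0; rewrite radmom_scale// lte_mul_pinfty ?lee_fin ?powR_ge0//.
by apply: radmom_lty => //; exact: exp_gt0.
Qed.

Lemma row_measurable_sqn_ratio k :
  row_measurable (fun v : 'rV[R]_n => sqn v ^+ k / enorm v `^ b).
Proof.
apply: row_measurableM; last exact: row_measurableW.
by apply: row_measurableX; exact: row_measurable_sqn.
Qed.

Lemma integrable_sqn k : (0 < k)%N ->
  integrable (fun v => sqn v ^+ k / enorm v `^ b).
Proof.
move=> k0; apply/integrableP; split.
  exact: (@row_measurableT_ball _ _ _ _ (row_measurable_sqn_ratio k)).
rewrite [ltLHS](_ : _ = radmom n k b (delta ^+ 2)); first exact: radmom_ball_lty.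
rewrite -integral_sqn_rad; apply: eq_integral => w _.
by rewrite abse_EFin ger0_norm// divr_ge0 ?powR_ge0// exprn_ge0// sqn_ge0.
Qed.

Lemma sqnmomE k : (0 < k)%N -> (sqnmom k)%:E = radmom n k b (delta ^+ 2).
Proof.
move=> k0; rewrite /sqnmom /ball_integral /Rintegral integral_sqn_rad fineK//.
by rewrite ge0_fin_numE ?radmom_ball_lty// radint_ge0// => q; exact: rker_indic_ge0.
Qed.

Lemma sqnmom_gt0 k : (0 < k)%N -> 0 < sqnmom k.
Proof.
move=> k0; rewrite -lte_fin sqnmomE// radmom_scale//.
by rewrite mule_gt0 ?radmom_gt0// lte_fin powR_gt0.
Qed.

(** On the unit ball, with a = n + 2k - b, the layer cake identity reads x = y + x / (a / 2 + 1).
    Both moments being finite, it solves to y = a / (a + 2) x. Rescaling to radius delta adds the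
    factor delta^2. *)
Lemma sqnmomS k : (0 < k)%N -> sqnmom k.+1 =
  delta ^+ 2 * (((n + k.*2)%:R - b) / ((n + k.*2)%:R - b + 2)) * sqnmom k.
Proof.
move=> k0; have := exp_gt0 k0; set a := _ - b => a0.
have rec := radmom_rec a0.
have fk := radmom_lty k0 a0.
have fk1 : (radmom n k.+1 b 1 < +oo)%E by apply: radmom_lty => //; exact: exp_gt0.
apply/EFin_inj; rewrite EFinM !sqnmomE//.
rewrite !radmom_scale// -/a.
have -> : (n + k.+1.*2)%:R - b = a + 2.
  by rewrite /a doubleS !addnS -!natr1; ring.
rewrite powRD ?(gt_eqF delta_gt0) ?implybT// powR_mulrn ?(ltW delta_gt0)//.
have p0 : (0 <= radmom n k b 1)%E by apply: radint_ge0 => q; exact: rker_indic_ge0.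
have p1 : (0 <= radmom n k.+1 b 1)%E by apply: radint_ge0 => q; exact: rker_indic_ge0.
move: rec fk fk1 p0 p1; rewrite -/a.
case: (radmom n k b 1) => [x| |]//; case: (radmom n k.+1 b 1) => [y| |]//.
rewrite -!EFinM -EFinD => -[E] _ _ _ _; congr EFin.
have -> : y = a / (a + 2) * x.
  have -> : y = x - (a / 2 + 1)^-1 * x by rewrite {1}E addrK.
  by field; rewrite gt_eqF// addr_gt0.
by ring.
Qed.

End weighted_moments.

(** * Directional moments *)

Section directional_moments.
Context {R : realType}.
Local Notation RT := (measurableTypeR R).
Variables (n : nat) (delta b : R).
Hypotheses (delta_gt0 : 0 < delta) (b_lt : b < n.+1%:R + 2).
Local Notation integrable := (@ball_integrable R n.+1 delta).
Local Notation Int := (@ball_integral R n.+1 delta).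
Implicit Types (F G : 'rV[R]_n.+1 -> R) (u v : 'rV[R]_n.+1).

Lemma normr_coord_le v i : `|v 0 i| <= enorm v.
Proof.
rewrite -sqrtr_sqr ler_sqrt ?sqn_ge0// (bigD1 i)//= lerDl.
by apply: sumr_ge0 => j _; exact: sqr_ge0.
Qed.

(** The l1 norm gives a bound |u.v| <= C |v| coordinate by coordinate; any constant depending on u
    alone is enough for the dominations below. *)
Definition norm1 u : R := \sum_i `|u 0 i|.

Lemma norm1_ge0 u : 0 <= norm1 u.
Proof. exact: sumr_ge0. Qed.

Lemma normr_dot_le u v : `|dot u v| <= norm1 u * enorm v.
Proof.
rewrite (le_trans (ler_norm_sum _ _ _))// mulr_suml ler_sum// => i _.
by rewrite normrM ler_wpM2l// normr_coord_le.
Qed.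

Lemma enorm_ge0 v : 0 <= enorm v.
Proof. exact: sqrtr_ge0. Qed.

Lemma enorm_exp2 v k : enorm v ^+ k.*2 = sqn v ^+ k.
Proof. by rewrite -mul2n exprM enorm_sqr. Qed.

Lemma weighted_integrable F C k : (0 < k)%N -> row_measurable F ->
  (forall v, `|F v| <= C * sqn v ^+ k) -> integrable (fun v => F v / enorm v `^ b).
Proof.
move=> k0 mF FC.
have iS := ball_integrableZ delta_gt0 C (integrable_sqn delta_gt0 b_lt k0).
apply: (le_ball_integrable delta_gt0 _ iS).
  by apply: row_measurableM => //; exact: row_measurableW.
move=> v _; rewrite normrM mulrA ler_pM// normfV ger0_norm// ?powR_ge0//.
Qed.

(** The indicator of the ball is a function of [sqn v], so it is absorbed into the function of the
    pair. *)
Lemma ball_integral_radial (h : R * R -> R) u :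
  measurable_fun setT (h : RT * RT -> RT) -> (forall p, 0 <= h p) ->
  Int (fun v => h (dot u v, sqn v)) = Int (fun v => h (enorm u * v 0 ord0, sqn v)).
Proof.
move=> mh h0; rewrite /ball_integral /Rintegral; congr fine.
rewrite integral_mkcond [RHS]integral_mkcond.
pose g (p : RT * RT) : \bar R :=
  (h p * \1_(`]-oo, (delta ^+ 2)[%classic : set RT) p.2)%:E.
have mg : measurable_fun setT g.
  apply/measurable_EFinP; apply: measurable_funM => //.
  apply: (@measurableT_comp _ _ _ _ _ _ (\1_(`]-oo, (delta ^+ 2)[%classic : set RT) : RT -> RT)).
    by apply: measurable_indic; exact: measurable_itv.
  exact: measurable_snd.
have g0 p : (0 <= g p)%E by rewrite lee_fin mulr_ge0.
have E (f : n.+1.-tuple RT -> R) w :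
  (((fun w => (h (f w, sqn (row_of_tuple w)))%:E)
    \_ [set w | enorm (row_of_tuple w) < delta]) w) = g (f w, sqn (row_of_tuple w)).
  rewrite patchE /g indic_itv in_itv/=.
  rewrite (_ : (w \in _) = (sqn (row_of_tuple w) < delta ^+ 2)).
    by case: ifPn => _; rewrite ?mulr1 ?mulr0.
  by rewrite -enorm_ltE//; apply/idP/idP; rewrite inE.
transitivity (\int[lebesgue_tuple n.+1]_w g (dot u (row_of_tuple w), sqn (row_of_tuple w)))%E.
  by apply: eq_integral => w _; exact: E.
apply: (etrans (ge0_integral_radial u mg g0)).
by apply: eq_integral => w _; rewrite (E (fun w => enorm u * row_of_tuple w 0 ord0)).
Qed.

(** This is M(k, l), computed in the direction e_0. *)
Definition coordmom k l := Int (fun v => v 0 ord0 ^+ k.*2 * sqn v ^+ l / enorm v `^ b).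

Lemma row_measurable_monomial i j k l m :
  row_measurable (fun v : 'rV[R]_n.+1 => v 0 i ^+ k * v 0 j ^+ l * sqn v ^+ m).
Proof.
by apply: row_measurableM; [apply: row_measurableM|]; apply: row_measurableX;
  [exact: row_measurable_coord|exact: row_measurable_coord|exact: row_measurable_sqn].
Qed.

Lemma integrable_monomial i j k l m p : (k + l = p.*2)%N -> (0 < p + m)%N ->
  integrable (fun v => v 0 i ^+ k * v 0 j ^+ l * sqn v ^+ m / enorm v `^ b).
Proof.
move=> klp pm; apply: (@weighted_integrable _ 1 (p + m)) => //.
  exact: row_measurable_monomial.
move=> v; rewrite mul1r exprD -(enorm_exp2 v p) -klp exprD.
rewrite !normrM !normrX (ger0_norm (sqn_ge0 v)).
by rewrite !ler_pM ?mulr_ge0 ?exprn_ge0 ?sqn_ge0// lerXn2r ?nnegrE ?enorm_ge0// normr_coord_le.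
Qed.

Lemma integrable_coordmom k l : (0 < k + l)%N ->
  integrable (fun v => v 0 ord0 ^+ k.*2 * sqn v ^+ l / enorm v `^ b).
Proof.
move=> kl; have := @integrable_monomial ord0 ord0 k.*2 0 l k (addn0 _) kl.
by under [X in ball_integrable _ X]eq_fun do rewrite expr0 mulr1.
Qed.

Lemma ball_integral_dot_exp2 k l u : (0 < k + l)%N ->
  Int (fun v => dot u v ^+ k.*2 * sqn v ^+ l / enorm v `^ b) =
  sqn u ^+ k * coordmom k l.
Proof.
(* The power 2k is written as a power of a square, so that [h] is visibly nonnegative on the whole
   plane. *)
move=> kl; pose h (p : R * R) := (p.1 ^+ 2) ^+ k * rker l b p.2.
have mh : measurable_fun setT (h : RT * RT -> RT).
  apply: measurable_funM.
    by do 2 apply: measurable_funX.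
  apply: (@measurableT_comp _ _ _ _ _ _ (rker l b : RT -> RT)) => //.
  exact: measurable_rker.
have h0 p : 0 <= h p by rewrite mulr_ge0 ?rker_ge0// exprn_ge0// sqr_ge0.
have rE v : rker l b (sqn v) = sqn v ^+ l / enorm v `^ b.
  by rewrite /rker (ger0_norm (sqn_ge0 _)).
transitivity (Int (fun v => h (dot u v, sqn v))).
  by apply: eq_ball_integral => v _; rewrite /h/= rE -exprM mul2n mulrA.
rewrite (ball_integral_radial u mh h0) -ball_integralZ//; last exact: integrable_coordmom.
apply: eq_ball_integral => v _; rewrite /h/= rE -exprM mul2n exprMn enorm_exp2.
by rewrite !mulrA.
Qed.

End directional_moments.

(** * Moment recursion by comparison of polynomial coefficients *)

Section moment_recursion.
Context {R : realType}.

(** In characteristic zero the naturals below the size of p - q are distinct roots of it, too many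
    for a nonzero polynomial. *)
Lemma poly_horner_inj (p q : {poly R}) : (forall x, p.[x] = q.[x]) -> p = q.
Proof.
move=> pq; apply/eqP; rewrite -subr_eq0; apply/eqP.
apply: (@roots_geq_poly_eq0 _ _ [seq i%:R | i <- iota 0 (size (p - q))]).
- by apply/allP => x _; rewrite /root hornerD hornerN pq subrr.
- by rewrite map_inj_uniq ?iota_uniq// => i j /eqP; rewrite eqr_nat => /eqP.
- by rewrite size_map size_iota.
Qed.

(** Needed because the squared norm of e_0 + t e_j is 1 + t^2. *)
Lemma coef2_exp_1DX2 m : ((1 + 'X^2) ^+ m : {poly R})`_2 = m%:R.
Proof.
have c0 k : ((1 + 'X^2) ^+ k : {poly R})`_0 = 1.
  elim: k => [|k IH]; first by rewrite expr0 coef1.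
  by rewrite exprS mulrDl mul1r coefD IH coefXnM addr0.
elim: m => [|m IH]; first by rewrite expr0 coef1.
by rewrite exprS mulrDl mul1r coefD IH coefXnM/= c0 natr1.
Qed.

Variables (n : nat) (delta b : R).
Hypotheses (delta_gt0 : 0 < delta) (b_lt : b < n.+1%:R + 2).
Local Notation integrable := (@ball_integrable R n.+1 delta).
Local Notation Int := (@ball_integral R n.+1 delta).
Implicit Types (F G : 'rV[R]_n.+1 -> R) (u v : 'rV[R]_n.+1).
Local Notation coordmom := (coordmom n delta b).

Lemma dot_delta m i (v : 'rV[R]_m) : dot (delta_mx 0 i) v = v 0 i.
Proof.
rewrite /dot (bigD1 i)//= mxE !eqxx mul1r big1 ?addr0// => j ji.
by rewrite mxE (negbTE ji) andbF mul0r.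
Qed.

Lemma dotDl m (u v w : 'rV[R]_m) : dot (u + v) w = dot u w + dot v w.
Proof. by rewrite -big_split; apply: eq_bigr => i _; rewrite mxE mulrDl. Qed.

Lemma dotZl m c (v w : 'rV[R]_m) : dot (c *: v) w = c * dot v w.
Proof. by rewrite mulr_sumr; apply: eq_bigr => i _; rewrite mxE mulrA. Qed.

Lemma dotC m (v w : 'rV[R]_m) : dot v w = dot w v.
Proof. by apply: eq_bigr => i _; rewrite mulrC. Qed.

Lemma sqn_dot m (v : 'rV[R]_m) : sqn v = dot v v.
Proof. by apply: eq_bigr => i _; rewrite expr2. Qed.

Lemma sqnDZ m (u v : 'rV[R]_m) t :
  sqn (u + t *: v) = sqn u + 2 * t * dot u v + t ^+ 2 * sqn v.
Proof.
rewrite !sqn_dot dotDl dotZl !(dotC _ (u + _)) !dotDl !dotZl (dotC v u).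
by ring.
Qed.

Lemma sqn_delta m i : sqn (delta_mx 0 i : 'rV[R]_m) = 1.
Proof. by rewrite sqn_dot dot_delta mxE !eqxx. Qed.

(* Coefficient of t^2 in the moment of order k + 1 in the direction e_0 + t e_j. *)
Lemma mixed_moment k l (j : 'I_n.+1) : j != ord0 ->
  (k.*2.+1)%:R *
    Int (fun v => v 0 ord0 ^+ k.*2 * v 0 j ^+ 2 * sqn v ^+ l / enorm v `^ b) =
  coordmom k.+1 l.
Proof.
move=> j0; pose N := (k.+1).*2.
pose I i := Int (fun v => v 0 ord0 ^+ (N - i) * v 0 j ^+ i * sqn v ^+ l / enorm v `^ b).
have iI i : (i <= N)%N -> integrable (fun v =>
    v 0 ord0 ^+ (N - i) * v 0 j ^+ i * sqn v ^+ l / enorm v `^ b).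
  by move=> iN; apply: (@integrable_monomial _ _ _ _ _ _ _ _ _ _ _ k.+1) => //; rewrite subnK.
have E : \poly_(i < N.+1) (I i *+ 'C(N, i)) =
    (coordmom k.+1 l)%:P * (1 + 'X^2) ^+ k.+1.
  apply: poly_horner_inj => t.
  rewrite horner_poly hornerM hornerC horner_exp hornerD hornerC hornerXn.
  pose u : 'rV[R]_n.+1 := delta_mx 0 ord0 + t *: delta_mx 0 j.
  have -> : 1 + t ^+ 2 = sqn u.
    rewrite /u sqnDZ !sqn_delta dot_delta mxE eqxx/= eq_sym (negbTE j0).
    by rewrite mulr0 addr0 mulr1.
  rewrite mulrC -ball_integral_dot_exp2//.
  pose T (i : 'I_N.+1) v := (t ^+ i *+ 'C(N, i)) *
     (v 0 ord0 ^+ (N - i) * v 0 j ^+ i * sqn v ^+ l / enorm v `^ b).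
  have iT i : integrable (T i).
    by apply: ball_integrableZ => //; apply: iI; rewrite -ltnS.
  transitivity (Int (fun v => \sum_(i < N.+1) T i v)); last first.
    apply: eq_ball_integral => v _.
    rewrite /u dotDl dotZl !dot_delta exprDn !mulr_suml.
    apply: eq_bigr => i _; rewrite /T exprMn.
    rewrite -/N; move: (v 0 ord0 ^+ _) (v 0 j ^+ _) (t ^+ _) 'C(N, i) => x y z m.
    by rewrite mulrnAl !mulrnAl; congr (_ *+ _); ring.
  rewrite (ball_integral_sum delta_gt0 _ iT).2; apply: eq_bigr => i _.
  rewrite ball_integralZ//; last by apply: iI; rewrite -ltnS.
  by rewrite -/(I i) mulrC mulrnAr mulrnAl.
have /(congr1 (fun p : {poly R} => p`_2)) := E.
rewrite coef_poly coefCM coef2_exp_1DX2 /N doubleS/= => {}E.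
have k0 : k.+1%:R != 0 :> R by rewrite pnatr_eq0.
(* The coefficient identity is C(2k + 2, 2) I_2 = (k + 1) M(k + 1, l). As C(2k + 2, 2) = (2k + 1)(k
   + 1), the factor k + 1 cancels. *)
apply: (mulIf k0); rewrite -E /I /N doubleS !subSS subn0 bin2.
have -> : ((k.*2.+2 * k.*2.+2.-1)./2 = k.*2.+1 * k.+1)%N.
  by rewrite -[X in (X * _)%N]/(k.+1.*2) -doubleMl doubleK mulnC.
by rewrite mulrnA mulr_natl mulr_natr.
Qed.

(** Expand one factor |v|^2 of M(k, l + 1) as the sum of the v_j^2: after multiplication by 2k + 1,
    the term j = 0 gives (2k + 1) M(k + 1, l) and each of the n others gives M(k + 1, l). *)
Lemma coordmomS k l :
  (n.+1 + k.*2)%:R * coordmom k.+1 l = k.*2.+1%:R * coordmom k l.+1.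
Proof.
pose T (j : 'I_n.+1) v := v 0 ord0 ^+ k.*2 * v 0 j ^+ 2 * sqn v ^+ l / enorm v `^ b.
have iT j : integrable (T j).
  by apply: (@integrable_monomial _ _ _ _ _ _ _ _ _ _ _ k.+1) => //; rewrite addn2.
have -> : coordmom k l.+1 = \sum_j Int (T j).
  rewrite -(ball_integral_sum delta_gt0 _ iT).2; apply: eq_ball_integral => v _.
  by rewrite /T -!mulr_suml -mulr_sumr exprS -/(sqn v) !mulrA.
rewrite big_ord_recl mulrDr mulr_sumr.
rewrite (eq_bigr (fun=> coordmom k.+1 l)) => [|j _]; last exact: mixed_moment.
rewrite sumr_const card_ord.
have -> : Int (T ord0) = coordmom k.+1 l.
  by apply: eq_ball_integral => v _; rewrite /T -exprD addn2.
by rewrite !mulr_natl -mulrnDr addSn addnC.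
Qed.

Lemma coordmomE k l : coordmom k l =
  \prod_(i < k) ((i.*2.+1)%:R / (n.+1 + i.*2)%:R) * sqnmom n.+1 delta b (k + l).
Proof.
elim: k l => [|k IH] l.
  rewrite big_ord0 mul1r; apply: eq_ball_integral => v _.
  by rewrite expr0 mul1r.
have c0 : (n.+1 + k.*2)%:R != 0 :> R by rewrite pnatr_eq0.
apply: (mulfI c0); rewrite coordmomS IH [(k.+1 + l)%N]addSnnS big_ord_recr/=.
by rewrite -!mulrA [LHS]mulrCA [RHS]mulrCA; congr (_ * _); rewrite [RHS]mulrCA mulVKf.
Qed.

Lemma second_moment i j :
  Int (fun v => v 0 i * v 0 j / enorm v `^ b) =
  (i == j)%:R * (sqnmom n.+1 delta b 1 / n.+1%:R).
Proof.
have K : coordmom 1 0 = sqnmom n.+1 delta b 1 / n.+1%:R.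
  by rewrite coordmomE big_ord1 mulrC; congr (_ * _); rewrite addn0 mul1r.
have D (u : 'rV[R]_n.+1) : Int (fun v => dot u v ^+ 2 / enorm v `^ b) = sqn u * coordmom 1 0.
  rewrite -[sqn u]expr1 -ball_integral_dot_exp2//.
  by apply: eq_ball_integral => v _; rewrite mulr1.
have iI k l : integrable (fun v => v 0 k * v 0 l / enorm v `^ b).
  have := @integrable_monomial _ _ _ _ delta_gt0 b_lt k l 1 1 0 1 erefl erefl.
  by under [X in ball_integrable _ X]eq_fun do rewrite !expr1 mulr1.
have S k : Int (fun v => v 0 k * v 0 k / enorm v `^ b) = coordmom 1 0.
  rewrite -[RHS]mul1r -(sqn_delta k) -D; apply: eq_ball_integral => v _.
  by rewrite dot_delta expr2.
have [->|ij] := eqVneq i j; first by rewrite mul1r S K.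
rewrite mul0r.
(* Polarisation: the moment in the direction e_i + e_j is 2 M(1, 0), already accounted for by the
   two squares, so the cross term vanishes. The scalar 1 makes [sqnDZ] and [dotZl] applicable. *)
have := D (delta_mx 0 i + 1 *: delta_mx 0 j).
rewrite sqnDZ !sqn_delta dot_delta mxE eqxx/= (negbTE ij).
rewrite (@eq_ball_integral _ _ _ _ (fun v => v 0 i * v 0 i / enorm v `^ b +
   v 0 j * v 0 j / enorm v `^ b + 2 * (v 0 i * v 0 j / enorm v `^ b))); last first.
  by move=> v _; rewrite dotDl dotZl !dot_delta; ring.
rewrite ball_integralD//; last 2 first.
- exact: ball_integrableD.
- exact: ball_integrableZ.
rewrite ball_integralD// ball_integralZ// !S mulr0 addr0 expr1n mul1r.
move: (Int _) => x; move: (coordmom 1 0) => y E; lra.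
Qed.

End moment_recursion.

(** * The hypergeometric series *)

Section exponentially_bounded_series.
Context {R : realType}.
Implicit Types c : R^nat.

(** Domination by the coefficients of C exp(M x). It is stable under termwise differentiation and
    gives convergence everywhere, so series can be differentiated repeatedly with no radius of
    convergence to track. *)
Definition expbounded c :=
  exists C M : R, forall k, `|c k| <= C * (M ^+ k / k`!%:R).

Lemma expbounded_diffs c : expbounded c -> expbounded (pseries_diffs c).
Proof.
move=> [C [M cM]]; exists (C * M), M => k.
rewrite /pseries_diffs normrM ger0_norm// -mulrA.
apply: (@le_trans _ _ (k.+1%:R * (C * (M ^+ k.+1 / k.+1`!%:R)))).
  by rewrite ler_wpM2l.
rewrite le_eqVlt; apply/orP; left; apply/eqP.
rewrite factS natrM exprS.
have s0 : k.+1%:R != 0 :> R by rewrite pnatr_eq0.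
have f0 : k`!%:R != 0 :> R by rewrite pnatr_eq0 -lt0n fact_gt0.
by move: s0 f0; move: (k.+1%:R : R) (k`!%:R : R) => s f s0 f0; field; rewrite ?s0 ?f0.
Qed.

Lemma expbounded_cvg c x : expbounded c -> cvgn (pseries c x).
Proof.
move=> [C [M cM]]; apply: normed_cvg.
apply: (@series_le_cvg _ _ (fun k => `|C| * exp_coeff (`|M| * `|x|) k)) => [k|k|k|].
- exact: normr_ge0.
- by rewrite mulr_ge0// exp_coeff_ge0// mulr_ge0.
- rewrite /= normrM normrX /exp_coeff /= exprMn mulrAC mulrA ler_wpM2r ?exprn_ge0//.
  rewrite (le_trans (cM k))// (le_trans (ler_norm _))// !normrM normrX.
  by rewrite normfV (@ger0_norm _ k`!%:R)// mulrA.
by apply: is_cvg_seriesZ; exact: is_cvg_series_exp_coeff.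
Qed.

Lemma is_derive_pseries c (x : R) : expbounded c ->
  is_derive x 1 (fun x => limn (pseries c x)) (limn (pseries (pseries_diffs c) x)).
Proof.
move=> bc; apply: (@pseries_snd_diffs _ _ (`|x| + 1)).
- exact: expbounded_cvg.
- exact/expbounded_cvg/expbounded_diffs.
- exact/expbounded_cvg/expbounded_diffs/expbounded_diffs.
- by rewrite [ltRHS]ger0_norm ?addr_ge0// ltrDl.
Qed.

End exponentially_bounded_series.

Section hypergeometric_kernel.
Context {R : realType}.
Variables (n : nat) (b : R).
Hypothesis b_lt : b < n%:R + 2.

Definition fs_coeff (k : nat) : R :=
  (pochhammer 1 k * pochhammer ((n%:R + 2 - b) / 2) k) /
  (pochhammer 2 k * (pochhammer ((n%:R + 2) / 2) k *
     pochhammer ((n%:R + 4 - b) / 2) k)) / k`!%:R.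

(** The factor z in front of the hypergeometric function shifts its coefficients by one and makes
    the constant term 0. *)
Definition fs_series (k : nat) : R := if k is k'.+1 then fs_coeff k' else 0.

Lemma pochhammer_gt0 (a : R) k : 0 < a -> 0 < pochhammer a k.
Proof. by move=> a0; apply: prodr_gt0 => i _; rewrite ltr_wpDr. Qed.

Lemma pochhammer_le (a a' : R) k : 0 <= a -> a <= a' -> pochhammer a k <= pochhammer a' k.
Proof.
move=> a0 aa'; apply: ler_prod => i _; rewrite addr_ge0//=.
by rewrite lerD2r.
Qed.

Lemma pochhammerS (a : R) k : pochhammer a k.+1 = pochhammer a k * (a + k%:R).
Proof. by rewrite /pochhammer big_ord_recr. Qed.

Lemma fs_coeff_ge0 k : 0 <= fs_coeff k.
Proof.
have b0 : 0 < n%:R + 2 - b by rewrite subr_gt0.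
by rewrite /fs_coeff !divr_ge0 ?mulr_ge0 ?ltW// pochhammer_gt0//; lra.
Qed.

(** Each numerator symbol is matched with a larger one below: (1)_k <= (2)_k, and the parameter (n +
    2 - b) / 2 is below (n + 4 - b) / 2. The remaining symbol is at least 1 because (n + 2) / 2 >=
    1. *)
Lemma fs_coeff_le k : fs_coeff k <= k`!%:R^-1.
Proof.
have b0 : 0 < n%:R + 2 - b by rewrite subr_gt0.
have n0 : 0 <= n%:R :> R by [].
rewrite -[leRHS]mul1r ler_wpM2r ?invr_ge0// ler_pdivrMr ?mul1r; last first.
  by rewrite !mulr_gt0// pochhammer_gt0//; lra.
have p0 : 0 < (n%:R + 2 - b) / 2 by lra.
have p0' : 0 < (n%:R + 4 - b) / 2 by lra.
have h3 : pochhammer ((n%:R + 2 - b) / 2) k <= pochhammer ((n%:R + 4 - b) / 2) k.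
  by apply: pochhammer_le; lra.
have h2 : 1 <= pochhammer ((n%:R + 2) / 2 : R) k.
  rewrite [leLHS](_ : _ = \prod_(i < k) (1 : R)); last by rewrite big1.
  rewrite /pochhammer.
  apply: ler_prod => i _; rewrite ler01/=; have i0 : 0 <= (i : nat)%:R :> R by [].
  lra.
rewrite ler_pM ?(ltW (pochhammer_gt0 _ _))//; first by apply: pochhammer_le; lra.
by rewrite (le_trans h3)// ler_peMl// ltW// pochhammer_gt0.
Qed.

Lemma fs_series_expbounded : expbounded fs_series.
Proof.
(* The index shift costs a factor k + 1, which 2^(k+1) absorbs; hence M = 2. *)
exists 1, 2 => -[|k]; first by rewrite normr0 mul1r divr_ge0 ?exprn_ge0.
rewrite mul1r /= ger0_norm ?fs_coeff_ge0// (le_trans (fs_coeff_le k))//.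
rewrite factS natrM invfM mulrA ler_peMl ?invr_ge0// ler_pdivlMr// mul1r.
by rewrite -natrX ler_nat ltnW// ltn_expl.
Qed.

Lemma fsE (z : R) : fs n b z = limn (pseries fs_series z).
Proof.
rewrite /fs /hypergeometric.
have -> : (fun k => (\prod_(a <- [:: 1; (n%:R + 2 - b) / 2]) pochhammer a k) /
    (\prod_(b0 <- [:: 2; (n%:R + 2) / 2; (n%:R + 4 - b) / 2]) pochhammer b0 k) *
    (z ^+ k / k`!%:R)) = (fun k => fs_coeff k * z ^+ k).
  apply/funext => k; rewrite !big_cons !big_nil !mulr1 /fs_coeff.
  by rewrite -[RHS]mulrA (mulrC (z ^+ k)).
apply/esym/cvg_lim => //.
rewrite -(cvg_shiftS (pseries fs_series z)).
rewrite (_ : (fun _ => _) = (fun N => z * series (fun k => fs_coeff k * z ^+ k) N)); last first.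
  apply/funext => N; rewrite /pseries /series/= big_nat_recl// mul0r add0r mulr_sumr.
  by apply: eq_bigr => k _; rewrite /= exprS mulrCA.
apply: cvgM; first exact: cvg_cst.
apply: (@expbounded_cvg R fs_coeff z); exists 1, 1 => k.
by rewrite mul1r expr1n mul1r ger0_norm ?fs_coeff_ge0// fs_coeff_le.
Qed.

Lemma fs_derive (z : R) :
  is_derive z 1 (fs n b) (limn (pseries (pseries_diffs fs_series) z)).
Proof.
rewrite (_ : fs n b = fun z => limn (pseries fs_series z)); last exact/funext/fsE.
exact/is_derive_pseries/fs_series_expbounded.
Qed.

Lemma derive1_fs : derive1 (fs n b) = fun z => limn (pseries (pseries_diffs fs_series) z).
Proof. by apply/funext => z; rewrite derive1E; have [_ ->] := fs_derive z. Qed.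

Lemma derivable_fs (z : R) : derivable (fs n b) z 1.
Proof. by have [] := fs_derive z. Qed.

Lemma derivable_derive1_fs (z : R) : derivable (derive1 (fs n b)) z 1.
Proof.
rewrite derive1_fs.
by have [] := is_derive_pseries z (expbounded_diffs fs_series_expbounded).
Qed.

End hypergeometric_kernel.

(** * Taylor bounds for sine and cosine *)

Section trigonometric_bounds.
Context {R : realType}.

Lemma MVT_from0 (f df : R -> R) (x : R) : (forall y : R, is_derive y 1 f (df y)) ->
  exists2 c, `|c| <= `|x| & f x - f 0 = df c * x.
Proof.
move=> fd.
have cf : continuous f.
  by move=> y; apply/differentiable_continuous/derivable1_diffP/(@ex_derive _ _ _ _ _ _ _ (fd y)).
have [x0|x0] := leP 0 x.
  have [|c] := @MVT_segment R f df 0 x x0 (fun y _ => fd y).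
    exact: continuous_subspaceT.
  rewrite in_itv/= subr0 => /andP[c0 cx] ->; exists c => //.
  by rewrite !ger0_norm.
have [|c] := @MVT_segment R f df x 0 (ltW x0) (fun y _ => fd y).
  exact: continuous_subspaceT.
rewrite in_itv/= sub0r => /andP[xc c0] E; exists c.
  by rewrite ler0_norm// ltr0_norm// lerN2.
by rewrite -opprB E mulrN opprK.
Qed.

Lemma normr_sin_le1 (x : R) : `|sin x| <= 1.
Proof. by rewrite ler_norml sin_le1 sin_geN1. Qed.

Lemma normr_sin_le (x : R) : `|sin x| <= `|x|.
Proof.
have [c _] := MVT_from0 x (@is_derive_sin R).
rewrite sin0 subr0 => ->; rewrite normrM ler_piMl//.
by rewrite ler_norml cos_le1 cos_geN1.
Qed.

Lemma normr_cosB1_le (x : R) : `|cos x - 1| <= `|x|.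
Proof.
have [c _] := MVT_from0 x (@is_derive_cos R).
by rewrite cos0 => ->; rewrite normrM normrN ler_piMl// normr_sin_le1.
Qed.

(** The intermediate point c satisfies |c| <= |x|, so |sin c| <= |x|. The constant 1 in place of 1/2
    is harmless. *)
Lemma normr_cosB1_le2 (x : R) : `|cos x - 1| <= x ^+ 2.
Proof.
have [c cx] := MVT_from0 x (@is_derive_cos R).
rewrite cos0 => ->; rewrite normrM normrN -real_normK ?num_real// expr2.
by rewrite ler_wpM2r// (le_trans (normr_sin_le c)).
Qed.

Lemma normr_sinB_le2 (x : R) : `|sin x - x| <= x ^+ 2.
Proof.
have fd (y : R) : is_derive y 1 (fun y => sin y - y) (cos y - 1).
  exact: is_deriveB.
have [c cx] := MVT_from0 x fd; rewrite sin0 !subr0 => ->.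
rewrite normrM -real_normK ?num_real// expr2.
by rewrite ler_wpM2r// (le_trans (normr_cosB1_le c)).
Qed.

(** The addition formula reduces the expansion at a to those of sine and cosine at 0, with a
    remainder uniform in a. *)
Lemma cos_taylor1_le (a h : R) : `|cos (a + h) - cos a + h * sin a| <= 2 * h ^+ 2.
Proof.
have -> : cos (a + h) - cos a + h * sin a =
    cos a * (cos h - 1) - sin a * (sin h - h) by rewrite cosD; ring.
rewrite (le_trans (ler_normB _ _))// mulrDl !mul1r lerD// normrM.
  by rewrite -[leRHS]mul1r ler_pM ?normr_cosB1_le2// ler_norml cos_le1 cos_geN1.
by rewrite -[leRHS]mul1r ler_pM ?normr_sinB_le2// normr_sin_le1.
Qed.

Lemma sin_taylor1_le (a h : R) : `|sin (a + h) - sin a - h * cos a| <= 2 * h ^+ 2.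
Proof.
have -> : sin (a + h) - sin a - h * cos a =
    sin a * (cos h - 1) + cos a * (sin h - h) by rewrite sinD; ring.
rewrite (le_trans (ler_normD _ _))// mulrDl !mul1r lerD// normrM.
  by rewrite -[leRHS]mul1r ler_pM ?normr_cosB1_le2// normr_sin_le1.
by rewrite -[leRHS]mul1r ler_pM ?normr_sinB_le2// ler_norml cos_le1 cos_geN1.
Qed.

(** Without the constant term every partial sum is O(x^2), hence integrable against the weight. *)
Definition cosB1_psum (N : nat) (x : R) := \sum_(0 <= k < N) cos_coeff' x k.+1.

Lemma cvg_cosB1_psum (x : R) : cosB1_psum ^~ x @ \oo --> cos x - 1.
Proof.
have c0 : cos_coeff' x 0 = 1 by rewrite /cos_coeff' expr0z mul1r expr0 divr1.
have := @cvg_cos_coeff' R x; rewrite -(cvg_shiftS (series (cos_coeff' x))) => cv.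
rewrite (_ : cosB1_psum ^~ x = (fun N => series (cos_coeff' x) N.+1 - 1)).
  by apply: cvgB => //; exact: cvg_cst.
by apply/funext => N; rewrite /series/= big_nat_recl// c0 addrC addKr.
Qed.

(** With x^2 factored out, (2k + 2)! >= k! compares what remains with the series of exp(X^2). The
    bound is uniform in N, as domination requires. *)
Lemma normr_cosB1_psum_le N (x X : R) : `|x| <= X ->
  `|cosB1_psum N x| <= expR (X ^+ 2) * x ^+ 2.
Proof.
move=> xX; rewrite (le_trans (ler_norm_sum _ _ _))//.
apply: (@le_trans _ _ (\sum_(0 <= k < N) exp_coeff (X ^+ 2) k * x ^+ 2)).
  apply: ler_sum => k _.
  rewrite /cos_coeff' normrM normfV normrM (ger0_norm (ler0n _ _)).
  rewrite -exprnP normrX normrN1 expr1n mul1r doubleS -[k.*2.+2]addn2 exprD normrM.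
  rewrite [`|x ^+ 2|]ger0_norm ?sqr_ge0// mulrAC ler_wpM2r ?sqr_ge0// /exp_coeff/=.
  rewrite ler_pM ?invr_ge0//.
    by rewrite -exprM mul2n normrX lerXn2r// nnegrE (le_trans _ xX).
  rewrite lef_pV2 ?posrE ?ltr0n ?fact_gt0// ler_nat leq_fact//.
  by rewrite -addnn -addnA leq_addr.
rewrite -mulr_suml ler_wpM2r ?sqr_ge0//.
apply: (@nondecreasing_cvgn_le _ (series (exp_coeff (X ^+ 2)))).
  apply/nondecreasing_seqP => k; rewrite /series/= big_nat_recr//= lerDl.
  by rewrite exp_coeff_ge0// sqr_ge0.
exact: is_cvg_series_exp_coeff.
Qed.

End trigonometric_bounds.

(** * The multiplier as a power series *)

Section multiplier_series.
Context {R : realType}.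
Variables (n : nat) (delta b : R).
Hypotheses (delta_gt0 : 0 < delta) (b_lt : b < n.+1%:R + 2).
Local Notation integrable := (@ball_integrable R n.+1 delta).
Local Notation Int := (@ball_integral R n.+1 delta).
Implicit Types (F G : 'rV[R]_n.+1 -> R) (u v : 'rV[R]_n.+1).
Local Notation coordmom := (coordmom n delta b).
Local Notation sqnmom := (sqnmom n.+1 delta b).

Lemma ball_integral_cvg (F_ : nat -> 'rV[R]_n.+1 -> R) F G :
  (forall k, row_measurable (F_ k)) -> integrable F -> integrable G ->
  (forall v, enorm v < delta -> F_ ^~ v @ \oo --> F v) ->
  (forall k v, enorm v < delta -> `|F_ k v| <= G v) ->
  (fun k => Int (F_ k)) @ \oo --> Int F.
Proof.
move=> mF iF iG cF FG; apply: fine_cvg.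
rewrite [X in _ --> X](_ : _ = (\int[lebesgue_tuple n.+1]_(w in
    [set w | (enorm (row_of_tuple w) < delta)%R]) (F (row_of_tuple w))%:E)%E); last first.
  rewrite /ball_integral /Rintegral fineK//.
  exact: (integrable_fin_num (measurable_ball_tuple delta_gt0) iF).
apply: (dominated_cvg (measurable_ball_tuple delta_gt0) _ _ _ iG).
- by move=> k; exact: (@row_measurableT_ball _ _ _ _ (mF k)).
- by move=> w wd; apply: cvg_EFin; [exact: nearW|exact: cF].
- by [].
- by move=> k w wd; rewrite lee_fin; exact: FG.
Qed.

Lemma cnormE : cnorm n.+1 delta b = 2 * n.+1%:R / sqnmom 1.
Proof.
rewrite /cnorm invfM invrK; congr (_ * _^-1).
by apply: eq_ball_integral => v _; rewrite enorm_sqr expr1.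
Qed.

Lemma sqnmom1_gt0 : 0 < sqnmom 1.
Proof. exact: sqnmom_gt0. Qed.

Lemma cnorm_gt0 : 0 < cnorm n.+1 delta b.
Proof. by rewrite cnormE divr_gt0 ?mulr_gt0// sqnmom1_gt0. Qed.

(** The choice of [cnorm] makes both sides 1 at k = 0; afterwards the ratios of consecutive terms
    agree. The odd factor 2k + 3 gained by the directional moment cancels one factor of the
    factorial, and the radial recursion supplies the parameters involving b. *)
Lemma coordmom_fs_coeff k :
  cnorm n.+1 delta b * coordmom k.+1 0 / (k.+1.*2)`!%:R =
  (delta ^+ 2 / 4) ^+ k * fs_coeff n.+1 b k.
Proof.
have s0 : sqnmom 1 != 0 by rewrite gt_eqF// sqnmom1_gt0.
elim: k => [|k IH].
  rewrite expr0 mul1r coordmomE// big_ord1 addn0 cnormE.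
  rewrite /fs_coeff /pochhammer !big_ord0 !mulr1 !divr1.
  have n0 : n.+1%:R != 0 :> R by rewrite pnatr_eq0.
  have -> : (1.*2)`!%:R = 2 :> R by [].
  have -> : ((@ord0 0).*2 = 0)%N by [].
  by rewrite addn0; field; rewrite nat1r n0.
have f0 m : m`!%:R != 0 :> R by rewrite pnatr_eq0 -lt0n fact_gt0.
have -> : cnorm n.+1 delta b * coordmom k.+2 0 / (k.+2.*2)`!%:R =
   (cnorm n.+1 delta b * coordmom k.+1 0 / (k.+1.*2)`!%:R) *
   (delta ^+ 2 / ((k.+1.*2).+2%:R * (n.+1 + k.+1.*2)%:R) *
    (((n.+1 + k.+1.*2)%:R - b) / ((n.+1 + k.+1.*2)%:R - b + 2))).
  rewrite !coordmomE// big_ord_recr/= !addn0 (sqnmomS delta_gt0 b_lt)//.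
  have -> : ((k.+2.*2)`! = k.+1.*2.+2 * (k.+1.*2.+1 * (k.+1.*2)`!))%N.
    by rewrite [k.+2.*2]doubleS 2!factS.
  rewrite natrM [in X in _ * X]natrM.
  move: (\prod_(i < k.+1) _) (sqnmom k.+1) (cnorm _ _ _) (f0 k.+1.*2) => P J c.
  have : k.+1.*2.+1%:R != 0 :> R by rewrite pnatr_eq0.
  have : k.+1.*2.+2%:R != 0 :> R by rewrite pnatr_eq0.
  have : (n.+1 + k.+1.*2)%:R != 0 :> R by rewrite pnatr_eq0.
  have : (n.+1 + k.+1.*2)%:R - b + 2 != 0.
    rewrite gt_eqF// addr_gt0// subr_gt0 (lt_le_trans b_lt)// natrD lerD2l.
    by rewrite doubleS (ler_nat _ 2).
  move: (k.+1.*2`!%:R : R) (k.+1.*2.+1%:R : R) (k.+1.*2.+2%:R : R) ((n.+1 + k.+1.*2)%:R : R).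
  by move=> f x y z a1 a2 a3 a4 a5; field; rewrite ?a1 ?a2 ?a3 ?a4 ?a5.
rewrite IH [(_ / 4) ^+ k.+1]exprSr -[LHS]mulrA -[RHS]mulrA; congr (_ * _).
rewrite /fs_coeff !pochhammerS [k.+1`!]factS (natrM _ k.+1 k`!).
have p1 : pochhammer 1 k != 0 :> R by rewrite gt_eqF// pochhammer_gt0.
have p2 : pochhammer 2 k != 0 :> R by rewrite gt_eqF// pochhammer_gt0.
have N0 : 0 <= n.+1%:R :> R by [].
have b0 : 0 < n.+1%:R + 2 - b by rewrite subr_gt0.
have k0 : 0 <= k%:R :> R by [].
have p3 : pochhammer ((n.+1%:R + 2 - b) / 2) k != 0 by rewrite gt_eqF// pochhammer_gt0//; lra.
have p4 : pochhammer ((n.+1%:R + 2) / 2) k != 0 :> R by rewrite gt_eqF// pochhammer_gt0//; lra.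
have p5 : pochhammer ((n.+1%:R + 4 - b) / 2) k != 0 by rewrite gt_eqF// pochhammer_gt0//; lra.
have q1 : (k.+1.*2.+2)%:R = 2 * k%:R + 4 :> R.
  have -> : (k.+1.*2.+2 = 2 * k + 4)%N by rewrite mul2n addn4 doubleS.
  by rewrite natrD natrM.
have q2 : (n.+1 + k.+1.*2)%:R = n.+1%:R + 2 * k%:R + 2 :> R.
  have -> : (n.+1 + k.+1.*2 = n.+1 + 2 * k + 2)%N by rewrite doubleS -addnA addn2 mul2n.
  by rewrite 2!natrD natrM.
have q3 : k.+1%:R = k%:R + 1 :> R by rewrite natr1.
rewrite q1 q2 q3.
have q4 : 2 * k%:R + 4 != 0 :> R by rewrite gt_eqF//; lra.
have q5 : n.+1%:R + 2 * k%:R + 2 != 0 :> R by rewrite gt_eqF//; lra.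
have q6 : n.+1%:R + 2 * k%:R + 2 - b + 2 != 0 by rewrite gt_eqF//; lra.
have q7 : k%:R + 1 != 0 :> R by rewrite gt_eqF//; lra.
have q8 : k`!%:R != 0 :> R by [].
have q9 : 2 + k%:R != 0 :> R by rewrite gt_eqF//; lra.
move: (pochhammer 1 k) (pochhammer 2 k) (pochhammer ((n.+1%:R + 2 - b) / 2) k)
  (pochhammer ((n.+1%:R + 2) / 2 : R) k) (pochhammer ((n.+1%:R + 4 - b) / 2) k)
  p1 p2 p3 p4 p5 => x1 x2 x3 x4 x5 p1 p2 p3 p4 p5.
clear N0 k0 b0 q1 q2 q3.
move: (n.+1%:R : R) (k%:R : R) (k`!%:R : R) q4 q5 q6 q7 q8 q9 => N x f q4 q5 q6 q7 q8 q9.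
field.
have -> : N + 4 - b + x * 2 = N + 2 * x + 2 - b + 2 by ring.
have -> : N + 2 + x * 2 = N + 2 * x + 2 by ring.
by rewrite q4 q5 q6 q7 q8 q9 p2 p4 p5.
Qed.

Lemma weighted_cosB1_integrable u :
  integrable (fun v => (cos (dot u v) - 1) / enorm v `^ b).
Proof.
apply: (@weighted_integrable _ _ _ _ delta_gt0 b_lt _ (norm1 u ^+ 2) 1) => //.
  apply: row_measurableB; last exact: measurable_cst.
  apply: (@measurableT_comp _ _ _ _ _ _ (@cos R : measurableTypeR R -> measurableTypeR R)).
    by apply: continuous_measurable_fun; exact: continuous_cos.
  exact: row_measurable_dot.
move=> v; apply: (le_trans (normr_cosB1_le2 _)); rewrite expr1 -enorm_sqr -exprMn.
by rewrite -[leLHS]real_normK ?num_real// lerXn2r ?nnegrE ?mulr_ge0 ?norm1_ge0 ?enorm_ge0//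
  normr_dot_le.
Qed.

Lemma ball_integral_cosB1_psum N u :
  Int (fun v => cosB1_psum N (dot u v) / enorm v `^ b) =
  \sum_(0 <= k < N) (- sqn u) ^+ k.+1 * (coordmom k.+1 0 / (k.+1.*2)`!%:R).
Proof.
pose T k v := ((-1) ^+ k.+1 / (k.+1.*2)`!%:R) *
  (dot u v ^+ k.+1.*2 * sqn v ^+ 0 / enorm v `^ b).
have iT0 k : integrable (fun v => dot u v ^+ k.+1.*2 * sqn v ^+ 0 / enorm v `^ b).
  apply: (@weighted_integrable _ _ _ _ delta_gt0 b_lt _ (norm1 u ^+ k.+1.*2) k.+1) => //.
    apply: row_measurableM; apply: row_measurableX.
      exact: row_measurable_dot.
    exact: row_measurable_sqn.
  move=> v; rewrite expr0 mulr1 normrX -enorm_exp2 -exprMn.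
  by rewrite lerXn2r ?nnegrE ?mulr_ge0 ?norm1_ge0 ?enorm_ge0//
  normr_dot_le.
have iT k : integrable (T k) by apply: ball_integrableZ.
transitivity (Int (fun v => \sum_(0 <= k < N) T k v)).
  apply: eq_ball_integral => v _; rewrite mulr_suml; apply: eq_bigr => k _.
  by rewrite /T /cos_coeff' expr0 mulr1 -exprnP; ring.
rewrite (ball_integral_sum delta_gt0 _ iT).2; apply: eq_bigr => k _.
rewrite ball_integralZ// ball_integral_dot_exp2//.
by rewrite -[- sqn u]mulN1r exprMn; ring.
Qed.

(** The cosine series is integrated term by term under dominated convergence. The prefactor 4 /
    delta^2 appears because the k-th coefficient carries (delta^2 / 4)^k while z^(k+1) carries one
    more such factor. *)
Lemma multiplierE u : multiplier n.+1 delta b u =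
  4 / delta ^+ 2 * fs n.+1 b (- 4^-1 * enorm u ^+ 2 * delta ^+ 2).
Proof.
set z := - 4^-1 * _ * _.
have d0 : delta != 0 by rewrite gt_eqF.
have cv1 : (fun N => cnorm n.+1 delta b *
    Int (fun v => cosB1_psum N (dot u v) / enorm v `^ b)) @ \oo -->
    multiplier n.+1 delta b u.
  apply: cvgM; first exact: cvg_cst.
  (* On the ball |u.v| <= [norm1 u * delta], which bounds the exponential; the remaining square is
     at most [norm1 u ^+ 2] times |v|^2. *)
  pose C := expR ((norm1 u * delta) ^+ 2) * norm1 u ^+ 2.
  apply: (@ball_integral_cvg _ _ (fun v => C * (sqn v ^+ 1 / enorm v `^ b))).
  - move=> N; apply: row_measurableM; last exact: row_measurableW.
    apply: measurable_sum => k; rewrite /cos_coeff'.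
    apply: measurable_funM; last exact: measurable_cst.
    apply: measurable_funM; first exact: measurable_cst.
    by apply: measurable_funX; exact: measurable_dot.
  - exact: weighted_cosB1_integrable.
  - by apply: ball_integrableZ => //; exact: integrable_sqn.
  - move=> v _; apply: cvgM; last exact: cvg_cst.
    exact: cvg_cosB1_psum.
  - move=> N v vd; rewrite normrM normfV (ger0_norm (powR_ge0 _ _)) mulrA.
    rewrite ler_wpM2r ?invr_ge0 ?powR_ge0//.
    have du := normr_dot_le u v.
    rewrite (le_trans (@normr_cosB1_psum_le _ N _ (norm1 u * delta) _))//.
      by rewrite (le_trans du)// ler_wpM2l ?norm1_ge0// ltW.
    rewrite /C -mulrA ler_wpM2l ?expR_ge0// expr1 -enorm_sqr -exprMn.
    by rewrite -[leLHS]real_normK ?num_real// lerXn2r ?nnegrE ?mulr_ge0 ?norm1_ge0 ?enorm_ge0.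
(* The index is [N.+1] because term 0 of [fs_series] is zero: N terms remain, matching
   [cosB1_psum N]. *)
have cv2 : (fun N => 4 / delta ^+ 2 * pseries (fs_series n.+1 b) z N.+1) @ \oo -->
    4 / delta ^+ 2 * fs n.+1 b z.
  apply: cvgM; first exact: cvg_cst.
  rewrite (fsE b_lt) (cvg_shiftS (pseries (fs_series n.+1 b) z)).
  apply: (@expbounded_cvg R (fs_series n.+1 b) z).
  exact: fs_series_expbounded.
apply: (cvg_unique _ cv1); first exact: norm_hausdorff.
apply: cvg_trans cv2; rewrite (_ : (fun N => cnorm _ _ _ * _) =
  (fun N => 4 / delta ^+ 2 * pseries (fs_series n.+1 b) z N.+1)); first exact: cvg_id.
apply/funext => N; rewrite ball_integral_cosB1_psum /pseries /series/= big_nat_recl//.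
rewrite mul0r add0r !mulr_sumr; apply: eq_bigr => k _ /=.
have -> : cnorm n.+1 delta b * ((- sqn u) ^+ k.+1 * (coordmom k.+1 0 / (k.+1.*2)`!%:R)) =
  (- sqn u) ^+ k.+1 * (cnorm n.+1 delta b * coordmom k.+1 0 / (k.+1.*2)`!%:R) by ring.
rewrite coordmom_fs_coeff.
have -> : z = - sqn u * (delta ^+ 2 / 4) by rewrite /z enorm_sqr; field.
rewrite [(- sqn u * _) ^+ k.+1]exprMn [(delta ^+ 2 / 4) ^+ k.+1]exprS.
move: (_ ^+ k.+1) (_ ^+ k) (fs_coeff _ _ _) => x y w.
by field.
Qed.

End multiplier_series.

(** * Derivatives of the multiplier *)

Section directional_derivatives.
Context {R : realType}.

(** A quadratic error puts the difference quotient within C |h| of L. Pointwise Taylor bounds can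
    thus be integrated directly, instead of differentiating under the integral sign. *)
Lemma is_derive_quadratic (V : normedModType R) (f : V -> R) (x v : V) (L C : R) :
  (forall h : R, `|f (h *: v + x) - f x - h * L| <= C * h ^+ 2) ->
  is_derive x v f L.
Proof.
move=> fq.
have cv : (fun h : R => h^-1 *: (f (h *: v + x) - f x)) @ 0^' --> L.
  apply/cvgrPdist_lt => e e0; near=> h.
  have h0 : h != 0 by near: h; exact: nbhs_dnbhs_neq.
  have -> : L - h^-1 *: (f (h *: v + x) - f x) =
      - (h^-1 * (f (h *: v + x) - f x - h * L)).
    by rewrite /GRing.scale/=; field.
  rewrite normrN normrM normfV.
  apply: (@le_lt_trans _ _ (`|C| * `|h|)).
    rewrite mulrC ler_pdivrMr ?normr_gt0// (le_trans (fq h))//.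
    rewrite -mulrA -expr2 real_normK ?num_real//.
    by rewrite ler_wpM2r ?sqr_ge0// ler_norm.
  (* Adding 1 makes the constant positive, so that it can be divided by. *)
  apply: (@le_lt_trans _ _ ((`|C| + 1) * `|h|)).
    by rewrite ler_wpM2r// lerDl.
  rewrite -ltr_pdivlMl ?ltr_wpDl//.
  near: h; apply: dnbhs0_lt.
  by rewrite mulr_gt0// invr_gt0 ltr_wpDl.
split; first by apply/cvg_ex; exists L.
exact/cvg_lim.
Unshelve. all: by end_near. Qed.

Variables (n : nat) (delta b : R).
Hypotheses (delta_gt0 : 0 < delta) (b_lt : b < n.+1%:R + 2).
Local Notation integrable := (@ball_integrable R n.+1 delta).
Local Notation Int := (@ball_integral R n.+1 delta).
Implicit Types (F G : 'rV[R]_n.+1 -> R) (u v : 'rV[R]_n.+1).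
Local Notation sqnmom := (sqnmom n.+1 delta b).
Local Notation e_ i := (delta_mx 0 i : 'rV[R]_n.+1).

Lemma dot_shift_delta h i u v : dot (h *: e_ i + u) v = dot u v + h * v 0 i.
Proof. by rewrite dotDl dotZl dot_delta addrC. Qed.

Lemma row_measurable_cos u : row_measurable (fun v => cos (dot u v)).
Proof.
apply: (@measurableT_comp _ _ _ _ _ _ (@cos R : measurableTypeR R -> measurableTypeR R)).
  by apply: continuous_measurable_fun; exact: continuous_cos.
exact: row_measurable_dot.
Qed.

Lemma row_measurable_sin u : row_measurable (fun v => sin (dot u v)).
Proof.
apply: (@measurableT_comp _ _ _ _ _ _ (@sin R : measurableTypeR R -> measurableTypeR R)).
  by apply: continuous_measurable_fun; exact: continuous_sin.
exact: row_measurable_dot.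
Qed.

Lemma coord_sqr_le v i : v 0 i ^+ 2 <= sqn v.
Proof. by rewrite /sqn (bigD1 i)//= lerDl; apply: sumr_ge0 => j _; exact: sqr_ge0. Qed.

Lemma row_measurable_weighted_sin u i :
  row_measurable (fun v => v 0 i * sin (dot u v) / enorm v `^ b).
Proof.
apply: row_measurableM; last exact: row_measurableW.
by apply: row_measurableM; [exact: row_measurable_coord|exact: row_measurable_sin].
Qed.

Lemma row_measurable_weighted_cos u i j :
  row_measurable (fun v => v 0 i * v 0 j * cos (dot u v) / enorm v `^ b).
Proof.
apply: row_measurableM; last exact: row_measurableW.
apply: row_measurableM; last exact: row_measurable_cos.
by apply: row_measurableM; exact: row_measurable_coord.
Qed.

Lemma weighted_sin_integrable u i :
  integrable (fun v => v 0 i * sin (dot u v) / enorm v `^ b).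
Proof.
apply: (@weighted_integrable _ _ _ _ delta_gt0 b_lt _ (norm1 u) 1) => //.
  by apply: row_measurableM; [exact: row_measurable_coord|exact: row_measurable_sin].
move=> v; rewrite expr1 -enorm_sqr expr2 mulrCA normrM ler_pM//.
  exact: normr_coord_le.
by rewrite (le_trans (normr_sin_le _))// normr_dot_le.
Qed.

Lemma weighted_cos_integrable u i j :
  integrable (fun v => v 0 i * v 0 j * cos (dot u v) / enorm v `^ b).
Proof.
apply: (@weighted_integrable _ _ _ _ delta_gt0 b_lt _ 1 1) => //.
  apply: row_measurableM; last exact: row_measurable_cos.
  by apply: row_measurableM; exact: row_measurable_coord.
move=> v; rewrite mul1r expr1 -enorm_sqr expr2 -[leRHS]mulr1 !normrM.
rewrite !ler_pM ?mulr_ge0//; try exact: normr_coord_le.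
by rewrite ler_norml cos_le1 cos_geN1.
Qed.

(** The first order remainder of the cosine is at most 2 h^2 v_i^2 <= 2 h^2 |v|^2, whose weighted
    integral is finite. *)
Lemma is_derive_multiplier u i :
  is_derive u (e_ i) (multiplier n.+1 delta b)
    (- (cnorm n.+1 delta b * Int (fun v => v 0 i * sin (dot u v) / enorm v `^ b))).
Proof.
set c := cnorm _ _ _.
apply: (@is_derive_quadratic _ _ _ _ _ (c * (2 * sqnmom 1))) => h.
rewrite /multiplier -/c.
have c0 : 0 < c by exact: cnorm_gt0.
pose Q v := (cos (dot (h *: e_ i + u) v) - 1) / enorm v `^ b -
  (cos (dot u v) - 1) / enorm v `^ b + h * (v 0 i * sin (dot u v) / enorm v `^ b).
have iC w := weighted_cosB1_integrable delta_gt0 b_lt w.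
have iS := weighted_sin_integrable u i.
have iS1 := integrable_sqn delta_gt0 b_lt (ltnSn 0).
have -> : c * Int (fun v => (cos (dot (h *: e_ i + u) v) - 1) / enorm v `^ b) -
  c * Int (fun v => (cos (dot u v) - 1) / enorm v `^ b) -
  h * - (c * Int (fun v => v 0 i * sin (dot u v) / enorm v `^ b)) = c * Int Q.
  rewrite /Q ball_integralD//; last 2 first.
    exact: ball_integrableB.
    exact: ball_integrableZ.
  by rewrite ball_integralB// ball_integralZ//; ring.
rewrite normrM (gtr0_norm c0) -mulrA ler_pM2l// mulrAC.
rewrite /sqnmom -ball_integralZ//.
apply: norm_ball_integral => //.
- have mC w : row_measurable (fun v => (cos (dot w v) - 1) / enorm v `^ b).
    apply: row_measurableM; last exact: row_measurableW.
    by apply: row_measurableB; [exact: row_measurable_cos|exact: measurable_cst].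
  apply: row_measurableD; first exact: row_measurableB.
  apply: row_measurableM; first exact: measurable_cst.
  exact: row_measurable_weighted_sin.
- exact: ball_integrableZ.
move=> v _; rewrite /Q dot_shift_delta -mulrBl mulrA -mulrDl.
rewrite normrM normfV (ger0_norm (powR_ge0 _ _)) [leRHS]mulrA ler_wpM2r ?invr_ge0 ?powR_ge0//.
have -> : cos (dot u v + h * v 0 i) - 1 - (cos (dot u v) - 1) + h * (v 0 i * sin (dot u v)) =
   cos (dot u v + h * v 0 i) - cos (dot u v) + (h * v 0 i) * sin (dot u v) by ring.
rewrite (le_trans (cos_taylor1_le _ _))// [(h * _) ^+ 2]exprMn -[leRHS]mulrA ler_wpM2l//.
by rewrite ler_wpM2l ?sqr_ge0// expr1 coord_sqr_le.
Qed.

Lemma is_derive_weighted_sin u i j :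
  is_derive u (e_ j) (fun u => Int (fun v => v 0 i * sin (dot u v) / enorm v `^ b))
    (Int (fun v => v 0 i * v 0 j * cos (dot u v) / enorm v `^ b)).
Proof.
(* The extra factor v_i is bounded by delta on the ball, so the second order moment dominates
   again. *)
apply: (@is_derive_quadratic _ _ _ _ _ (2 * delta * sqnmom 1)) => h.
pose Q v := v 0 i * sin (dot (h *: e_ j + u) v) / enorm v `^ b -
  v 0 i * sin (dot u v) / enorm v `^ b -
  h * (v 0 i * v 0 j * cos (dot u v) / enorm v `^ b).
have iS w := weighted_sin_integrable w i.
have iC := weighted_cos_integrable u i j.
have iS1 := integrable_sqn delta_gt0 b_lt (ltnSn 0).
rewrite -ball_integralB// -ball_integralZ// -ball_integralB//; last 2 first.
  exact: ball_integrableB.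
  exact: ball_integrableZ.
rewrite mulrAC /sqnmom -ball_integralZ//.
apply: norm_ball_integral => //.
- apply: row_measurableB.
    by apply: row_measurableB; exact: row_measurable_weighted_sin.
  apply: row_measurableM; first exact: measurable_cst.
  exact: row_measurable_weighted_cos.
- exact: ball_integrableZ.
move=> v vd; rewrite dot_shift_delta -mulrBl mulrA -mulrBl.
rewrite normrM normfV (ger0_norm (powR_ge0 _ _)) [leRHS]mulrA ler_wpM2r ?invr_ge0 ?powR_ge0//.
have -> : v 0 i * sin (dot u v + h * v 0 j) - v 0 i * sin (dot u v) -
    h * (v 0 i * v 0 j * cos (dot u v)) =
  v 0 i * (sin (dot u v + h * v 0 j) - sin (dot u v) - (h * v 0 j) * cos (dot u v)) by ring.
rewrite normrM (_ : 2 * delta * h ^+ 2 * sqn v ^+ 1 = delta * (2 * (h ^+ 2 * sqn v))); last by ring.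
rewrite ler_pM//; first by rewrite (le_trans (normr_coord_le _ _))// ltW.
rewrite (le_trans (sin_taylor1_le _ _))// exprMn ler_wpM2l//.
by rewrite ler_wpM2l ?sqr_ge0// coord_sqr_le.
Qed.

End directional_derivatives.

(** * Gradient and Hessian, through moments and through the hypergeometric function *)

Section multiplier_calculus.
Context {R : realType}.
Variables (n : nat) (delta b : R).
Hypotheses (delta_gt0 : 0 < delta) (b_lt : b < n.+1%:R + 2).
Local Notation Int := (@ball_integral R n.+1 delta).
Implicit Types (u v : 'rV[R]_n.+1).
Local Notation sqnmom := (sqnmom n.+1 delta b).
Local Notation e_ i := (delta_mx 0 i : 'rV[R]_n.+1).
Local Notation m := (@multiplier R n.+1 delta b).
Local Notation c := (@cnorm R n.+1 delta b).
Local Notation f := (@fs R n.+1 b).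

(** Through the square of the norm this is a polynomial in the coordinates, hence differentiable at
    u = 0 too. *)
Definition zarg (u : 'rV[R]_n.+1) : R := - 4^-1 * enorm u ^+ 2 * delta ^+ 2.

Lemma is_derive_coord u i j : is_derive u (e_ i) (fun u => u 0 j) (i == j)%:R.
Proof.
apply: (@is_derive_quadratic _ _ _ _ _ _ 0) => h.
by rewrite !mxE eqxx/= [j == i]eq_sym addrK subrr normr0 mul0r.
Qed.

Lemma is_derive_zarg u i : is_derive u (e_ i) zarg (- (delta ^+ 2 / 2) * u 0 i).
Proof.
apply: (@is_derive_quadratic _ _ _ _ _ _ (delta ^+ 2 / 4)) => h.
rewrite /zarg !enorm_sqr [h *: _ + u]addrC sqnDZ sqn_delta dotC dot_delta.
rewrite [X in `|X|](_ : _ = - (delta ^+ 2 / 4 * h ^+ 2)); last by field.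
by rewrite normrN ger0_norm// mulr_ge0 ?sqr_ge0// divr_ge0 ?sqr_ge0.
Qed.

Lemma differentiable_zarg u : differentiable zarg u.
Proof.
rewrite (_ : zarg = fun u => (- 4^-1 * delta ^+ 2) *:
    (\sum_(i < n.+1) (fun u : 'rV[R]_n.+1 => (u 0 i * u 0 i : R))) u).
  apply: differentiableZ; apply: differentiable_sum => i.
  by apply: (@differentiableM _ _ (fun u => u 0 i) (fun u => u 0 i));
    exact: differentiable_coord.
apply/funext => v; rewrite fct_sumE /zarg enorm_sqr /GRing.scale/= mulrAC.
by congr (_ * _); apply: eq_bigr => i _; rewrite expr2.
Qed.

Lemma differentiable_comp_zarg (g : R -> R) u : derivable g (zarg u) 1 ->
  differentiable (fun u => g (zarg u)) u.
Proof.
move=> dg; apply: (@differentiable_comp _ _ _ _ zarg g).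
  exact: differentiable_zarg.
exact/derivable1_diffP.
Qed.

Lemma is_derive_comp_zarg (g : R -> R) u i : derivable g (zarg u) 1 ->
  is_derive u (e_ i) (fun u => g (zarg u))
    (- (delta ^+ 2 / 2) * u 0 i * derive1 g (zarg u)).
Proof.
move=> dg; have dgz := differentiable_comp_zarg dg.
split; first exact: diff_derivable.
have dg' : differentiable g (zarg u) by exact/derivable1_diffP.
have dz := differentiable_zarg u.
rewrite (deriveE _ dgz) (diff_comp dz dg')/= (diff1E dg') -(deriveE _ dz).
by rewrite (@derive_val _ _ _ _ _ _ _ (is_derive_zarg u i)).
Qed.

Lemma multiplierfE : m = fun u => 4 / delta ^+ 2 * f (zarg u).
Proof. by apply/funext => u; rewrite multiplierE. Qed.

Lemma differentiable_multiplier u : differentiable m u.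
Proof.
rewrite multiplierfE; apply: (@differentiableZ _ _ _ (fun u => f (zarg u)) (4 / delta ^+ 2)).
by apply: differentiable_comp_zarg; exact: derivable_fs.
Qed.

(** The prefactor 4 / delta^2 meets the inner derivative -(delta^2 / 2) u_i, and delta cancels. *)
Lemma derive_multiplier i u : 'D_(e_ i) m u = - 2 * derive1 f (zarg u) * u 0 i.
Proof.
rewrite multiplierfE.
have H := is_derive_comp_zarg i (@derivable_fs R _ _ b_lt (zarg u)).
have dH := @ex_derive _ _ _ _ _ _ _ H.
rewrite (deriveZ (4 / delta ^+ 2) dH) (@derive_val _ _ _ _ _ _ _ H) /GRing.scale/=.
by field; rewrite gt_eqF.
Qed.

Lemma grad_multiplierE :
  grad m = fun u => (- 2 * derive1 f (zarg u)) *: u.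
Proof. by apply/funext => u; apply/rowP => i; rewrite !mxE derive_multiplier. Qed.

Lemma differentiable_grad_multiplier u : differentiable (grad m) u.
Proof.
pose k i u := - 2 * derive1 f (zarg u) * u 0 i.
rewrite (_ : grad m = \sum_(i < n.+1) (fun u => k i u *: e_ i)).
  apply: differentiable_sum => i; apply: differentiableZl.
  apply: differentiableM; last exact: differentiable_coord.
  apply: (@differentiableZ _ _ _ (fun u => derive1 f (zarg u)) (- 2)).
  by apply: differentiable_comp_zarg; exact: derivable_derive1_fs.
apply/funext => v; rewrite fct_sumE grad_multiplierE; apply/rowP => i.
rewrite !mxE summxE (bigD1 i)//= big1 ?addr0 => [|j ji].
  by rewrite !mxE !eqxx mulr1.
by rewrite !mxE eq_sym (negbTE ji) andbF mulr0.
Qed.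

Lemma derive_multiplier_moment i u :
  'D_(e_ i) m u = - (c * Int (fun v => v 0 i * sin (dot u v) / enorm v `^ b)).
Proof. exact: (@derive_val _ _ _ _ _ _ _ (is_derive_multiplier delta_gt0 b_lt u i)). Qed.

Lemma sine_momentE u i : sine_moment n.+1 delta b u 0 i =
  Int (fun v => v 0 i * sin (dot u v) / enorm v `^ b).
Proof. by rewrite mxE; apply: eq_ball_integral => v _; rewrite mulrAC. Qed.

Lemma grad_multiplier_sine_moment u : grad m u = - c *: sine_moment n.+1 delta b u.
Proof.
apply/rowP => i; rewrite [LHS]mxE derive_multiplier_moment mxE sine_momentE.
by rewrite mulNr.
Qed.

(** Product rule on -2 f'(z) u_j: differentiating f' gives the factor delta^2 u_i u_j,
    differentiating u_j gives the identity matrix. *)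
Lemma hessian_multiplierE u :
  hessian m u = (delta ^+ 2 * derive1n 2 f (zarg u)) *: tens u u -
    (2 * derive1 f (zarg u))%:M.
Proof.
apply/matrixP => i j; rewrite !mxE.
rewrite (_ : 'D_(e_ j) m = fun u => (- 2 * derive1 f (zarg u)) * u 0 j); last first.
  by apply/funext => v; exact: derive_multiplier.
have H1 := is_derive_comp_zarg i (@derivable_derive1_fs R _ _ b_lt (zarg u)).
have H2 := is_derive_coord u i j.
have H3 := is_deriveM (is_deriveZ (- 2) H1) H2.
rewrite (@derive_val _ _ _ _ _ _ _ H3) /GRing.scale/=.
move: (derive1 f (zarg u)) (derive1 (derive1 f) (zarg u)) => x y.
rewrite /GRing.scale/=.
by case: (i == j); rewrite ?(mulr1n, mulr0n, mulr1, mulr0); field.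
Qed.

Lemma hessian_multiplier_moment u i j : hessian m u i j =
  - (c * Int (fun v => v 0 j * v 0 i * cos (dot u v) / enorm v `^ b)).
Proof.
rewrite mxE (_ : 'D_(e_ j) m =
  fun u => - c * Int (fun v => v 0 j * sin (dot u v) / enorm v `^ b)); last first.
  by apply/funext => v; rewrite derive_multiplier_moment mulNr.
have H := is_derive_weighted_sin delta_gt0 b_lt u j i.
rewrite (deriveZ (- c) (@ex_derive _ _ _ _ _ _ _ H)) (@derive_val _ _ _ _ _ _ _ H).
by rewrite /GRing.scale/= mulNr.
Qed.

(** The numerator v_i v_j tames the weight by itself, so cos - 1 may be split into two integrable
    parts: the cosine moment and a plain second moment. *)
Lemma bond_moment_hessian u i j :
  c * Int (fun v => tens v v i j / enorm v `^ b * (cos (dot u v) - 1)) =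
  - (hessian m u i j + (i == j)%:R * 2).
Proof.
have iC := weighted_cos_integrable delta_gt0 b_lt u i j.
have iB : ball_integrable delta
    (fun v : 'rV[R]_n.+1 => v 0 i * v 0 j / enorm v `^ b).
  have := @integrable_monomial _ _ _ _ delta_gt0 b_lt i j 1 1 0 1 erefl erefl.
  by under [X in ball_integrable _ X]eq_fun do rewrite !expr1 mulr1.
rewrite hessian_multiplier_moment.
have -> : Int (fun v => tens v v i j / enorm v `^ b * (cos (dot u v) - 1)) =
    Int (fun v => v 0 j * v 0 i * cos (dot u v) / enorm v `^ b) -
    Int (fun v => v 0 i * v 0 j / enorm v `^ b).
  have -> : Int (fun v => v 0 j * v 0 i * cos (dot u v) / enorm v `^ b) =
      Int (fun v => v 0 i * v 0 j * cos (dot u v) / enorm v `^ b).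
    by apply: eq_ball_integral => v _; rewrite (mulrC (v 0 j)).
  rewrite -ball_integralB//; apply: eq_ball_integral => v _.
  by rewrite mxE; ring.
rewrite (second_moment delta_gt0 b_lt) cnormE.
have J0 : sqnmom 1 != 0 by rewrite gt_eqF// sqnmom1_gt0.
have n0 : n.+1%:R != 0 :> R by rewrite pnatr_eq0.
move: (n.+1%:R : R) n0 (Int _) (sqnmom 1) J0 ((i == j)%:R : R) => N n0 I J J0 d.
by field; rewrite J0 n0.
Qed.

End multiplier_calculus.

(** * The tensor multipliers *)

Section tensor_multipliers.
Context {R : realType}.
Variables (n : nat) (delta mu : R).
Hypothesis delta_gt0 : 0 < delta.

(** The kernel of M_b has exponent beta + 2; this shift lets part (1) reuse the analysis of [fs]. *)
Lemma fbE m (beta : R) : fb m beta = fs m (beta + 2).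
Proof.
apply/funext => z; rewrite /fb /fs.
have -> : m%:R + 2 - (beta + 2) = m%:R - beta by ring.
by have -> : m%:R + 4 - (beta + 2) = m%:R + 2 - beta by ring.
Qed.

(** M_b is normalised with exponent beta, whereas the second derivatives carry the constant for beta
    + 2; hence the quotient of the two constants. *)
Lemma Mb_hessian beta (u : 'rV[R]_n.+1) : beta < n.+1%:R ->
  Mb n.+1 delta beta mu u =
  - ((n.+1%:R + 2) * mu * cnorm n.+1 delta beta / cnorm n.+1 delta (beta + 2)) *:
  (hessian (multiplier n.+1 delta (beta + 2)) u + 2%:M).
Proof.
rewrite -(ltrD2r 2) => b_lt; apply/matrixP => i j.
have c0 : cnorm n.+1 delta (beta + 2) != 0 by rewrite gt_eqF// cnorm_gt0.
have E := bond_moment_hessian delta_gt0 b_lt u i j.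
move: (hessian _ u) E => H E; rewrite /Mb !mxE.
rewrite -[2 *+ (i == j)]mulr_natl -[H i j + _]opprK -E.
move: (ball_integral _ _) (cnorm _ _ (beta + 2)) c0 => I c c0; by field.
Qed.

Lemma Mb_fb beta (u : 'rV[R]_n.+1) : beta < n.+1%:R ->
  hessian (multiplier n.+1 delta (beta + 2)) u + 2%:M =
  (delta ^+ 2 * derive1n 2 (fb n.+1 beta) (zarg delta u)) *: tens u u +
  (2 - 2 * derive1 (fb n.+1 beta) (zarg delta u))%:M.
Proof.
rewrite -(ltrD2r 2) => b_lt.
rewrite fbE hessian_multiplierE//.
by rewrite -addrA raddfB/= [- _ + _]addrC.
Qed.

Lemma tensZ m (k : R) (u : 'rV[R]_m) : tens (k *: u) (k *: u) = k ^+ 2 *: tens u u.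
Proof. by apply/matrixP => i j; rewrite !mxE; ring. Qed.

End tensor_multipliers.

Unset Implicit Arguments.

(** The derivative operators are total functions, so the differentiability clauses certify that the
    derivatives in the identities exist. *)
Theorem proposition2 (R : realType) (n : nat) (delta mu lambda : R)
    (n_ge1 : (1 <= n)%N) (delta_gt0 : 0 < delta) :
  (forall beta : R, beta < n%:R -> forall nu : 'rV[R]_n,
     let m := multiplier n delta (beta + 2) in
     let f := fb n beta in
     let z : R := - 4^-1 * enorm nu ^+ 2 * delta ^+ 2 in
     let K : R := (n%:R + 2) * mu * cnorm n delta beta /
              cnorm n delta (beta + 2) in
     [/\ differentiable m nu /\ differentiable (grad m) nu,
         derivable f z 1 /\ derivable (derive1 f) z 1,
         Mb n delta beta mu nu = - K *: (hessian m nu + 2%:M) &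
         Mb n delta beta mu nu =
           - K *: ((delta ^+ 2 * derive1n 2 f z) *: tens nu nu +
                   (2 - 2 * derive1 f z)%:M)]) /\
  (forall beta : R, beta < n%:R + 2 -> forall nu : 'rV[R]_n,
     let m := multiplier n delta beta in
     let f := fs n beta in
     let z : R := - 4^-1 * enorm nu ^+ 2 * delta ^+ 2 in
     [/\ differentiable m nu,
         derivable f z 1,
         Ms n delta beta mu lambda nu =
           (- (lambda - mu) / 4) *: tens (grad m nu) (grad m nu) &
         Ms n delta beta mu lambda nu =
           (- (lambda - mu) * (derive1 f z) ^+ 2) *: tens nu nu]).
Proof.
case: n n_ge1 => [//|n] _; split=> beta b_lt nu m f z.
  have b_lt2 : beta + 2 < n.+1%:R + 2 by rewrite ltrD2r.
  move=> K; split.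
  - split; first exact: differentiable_multiplier.
    exact: differentiable_grad_multiplier.
  - rewrite /f fbE; split; first exact: derivable_fs.
    exact: derivable_derive1_fs.
  - exact: Mb_hessian.
  - by rewrite Mb_hessian// Mb_fb.
have c0 : cnorm n.+1 delta beta != 0 by rewrite gt_eqF// cnorm_gt0.
have MsE : Ms n.+1 delta beta mu lambda nu =
    (- (lambda - mu) / 4) *: tens (grad m nu) (grad m nu).
  (* The minus sign in grad m = -c S disappears in the tensor square. *)
  rewrite /Ms /m grad_multiplier_sine_moment// tensZ scalerA sqrrN.
  by congr (_ *: _); ring.
split.
- exact: differentiable_multiplier.
- exact: derivable_fs.
- exact: MsE.
(* The factor 4 from squaring -2 f'(z) cancels the denominator. *)
- rewrite MsE /m grad_multiplierE// tensZ scalerA; congr (_ *: _).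
  by rewrite -/f -[zarg _ _]/z; field.
Qed.
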